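(* Let $S$ be a nonnegative symmetric linear relation in a complex Hilbert space $\mathcal H$ having a non-unique nonnegative selfadjoint extension. Then for any two extremal nonnegative selfadjoint extensions $\widetilde S_1,\widetilde S_2$ of $S$ the arithmetic--harmonic means $ah(\widetilde S_1,\widetilde S_2)$ are extremal nonnegative selfadjoint extensions of $S$ too. Moreover, $$ah(\widetilde S_1,\widetilde S_2)=\big\langle\widetilde S_1^{(1)},\widetilde S_2^{(1)}\big\rangle,\qquad \widetilde S_1^{(1)}=\tfrac12(\widetilde S_1\dot+\widetilde S_2),\quad \widetilde S_2^{(1)}=h(\widetilde S_1,\widetilde S_2).$$ In particular, $ah(S_{\rm F},S_{\rm K})=\langle S_{\rm F},S_{\rm K}\rangle$, where $S_{\rm F}$ and $S_{\rm K}$ are the Friedrichs and Kreĭn extensions of $S$.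
   Context: A linear relation (l.r.) in $\mathcal H$ is a closed linear subspace $A=\{\{f,f'\}\}$ of $\mathcal H\oplus\mathcal H$; $\operatorname{mul}A=\{f':\{0,f'\}\in A\}$; $A^{-1}=\{\{f',f\}:\{f,f'\}\in A\}$; $\lambda A=\{\{f,\lambda f'\}\}$. $A$ is symmetric if $A\subseteq A^*$, selfadjoint if $A=A^*$, where $A^*:=\{\{g,g'\}:(f',g)=(f,g')\ \forall\{f,f'\}\in A\}$; nonnegative if $(f',f)\ge0$ for all $\{f,f'\}\in A$. A nonnegative selfadjoint l.r. decomposes as $A=\mathrm{Graph}(A_o)\oplus(\{0\}\oplus\operatorname{mul}A)$ with $A_o$ a nonnegative selfadjoint operator in $\mathcal H\ominus\operatorname{mul}A$. The closed form of $A$ is $A[\varphi]=\|A_o^{1/2}\varphi\|^2$, $\varphi\in\mathcal D[A]=\operatorname{dom}A_o^{1/2}$; this gives a bijection between nonnegative selfadjoint l.r. and closed nonnegative (not necessarily densely defined) forms. The form sum $A\dot+B$ is the nonnegative selfadjoint l.r. associated with the closed form $A[\varphi]+B[\varphi]$, $\varphi\in\mathcal D[A]\cap\mathcal D[B]$. The harmonic mean is $h(A,B):=\big(\tfrac12(A^{-1}\dot+B^{-1})\big)^{-1}$. Arithmetic--harmonic means: for nonnegative selfadjoint l.r. $A,B$ put $A_0=A$, $B_0=B$, $A_n=\tfrac12(A_{n-1}\dot+B_{n-1})$, $B_n=h(A_{n-1},B_{n-1})$, $n\ge1$. The limits $A_\infty,B_\infty$ of $\{A_n\},\{B_n\}$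 in the strong resolvent sense (strong convergence of $(A_n+I)^{-1}$ to $(A_\infty+I)^{-1}$, similarly for $B_n$) exist, and $ah(A,B):=\langle A_\infty,B_\infty\rangle$ (ordered pair). For a nonnegative symmetric l.r. $S$, the Friedrichs extension $S_{\rm F}$ is the nonnegative selfadjoint l.r. associated with the closure of the form $\mathfrak s[f,g]=(f',g)$, $\{f,f'\},\{g,g'\}\in S$; the Kreĭn extension is $S_{\rm K}=((S^{-1})_{\rm F})^{-1}$. A nonnegative selfadjoint extension $\widetilde S$ of $S$ is called extremal if $\inf\{(f'-g',f-g):\{g,g'\}\in S\}=0$ for all $\{f,f'\}\in\widetilde S$. *)

(* Defs.v *)
From HB Require Import structures.
From mathcomp Require Import all_boot all_order all_algebra.
From mathcomp Require Import all_classical all_reals all_analysis.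
From mathcomp Require Import complex.

Set Implicit Arguments.
Unset Strict Implicit.
Unset Printing Implicit Defensive.

Import Order.TTheory GRing.Theory Num.Theory numFieldNormedType.Exports.

Local Open Scope classical_set_scope.
Local Open Scope ring_scope.
Local Open Scope complex_scope.

(* The inner product [dot] is linear in its first argument.  It is a parameter
   separate from the norm of [H]; a complex Hilbert space is a complete normed
   R[i]-module together with a [dot] such that [`|x| ^+ 2 = dot x x].

   Objects that the theory introduces by existence and uniqueness (values of an
   operator graph, square roots, relations associated with a form, limits) are
   obtained with [xget]; the default value is returned only when no such object
   exists. *)

(* Sesquilinear forms with a domain; [fval] is meaningful on [fdom] only. *)
Record sform (R : realType) (H : completeNormedModType R[i]) := SForm {
  fdom : set H ;
  fval : H -> H -> R[i] }.

Section LinearRelations.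
Variables (R : realType) (H : completeNormedModType R[i]).
Variable dot : {dot H for (@Num.conj R[i])}.

Implicit Types (A B S T : set (H * H)) (L M : set H) (t s : sform H).

Definition linear_relation A :=
  [/\ A 0, forall (a : R[i]) x y, A x -> A y -> A (a *: x + y) & closed A].

Definition dom A : set H := [set f | exists f', A (f, f')].

Definition mul A : set H := [set f' | A (0, f')].

Definition scale_lr (a : R[i]) A : set (H * H) :=
  [set (f.1, a *: f.2) | f in A].

Definition adjoint A : set (H * H) :=
  [set g | forall f, A f -> dot f.2 g.1 = dot f.1 g.2].

(* On complex numbers [0 <= z] says that z is real and nonnegative. *)
Definition nonneg_lr A := forall f, A f -> 0 <= dot f.2 f.1.

Definition nonneg_symmetric A :=
  [/\ linear_relation A, A `<=` adjoint A & nonneg_lr A].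

(* Nonnegative selfadjoint relation in the closed subspace [L] of [H]: the
   adjoint is taken within L x L. *)
Definition nonneg_selfadjoint_in L A :=
  [/\ linear_relation A, adjoint A `&` (L `*` L) = A & nonneg_lr A].

Definition nonneg_selfadjoint A := nonneg_selfadjoint_in setT A.

(* The value at [f] of the operator with graph [A]. *)
Definition lr_val A (f : H) : H := xget 0 [set f' | A (f, f')].

Definition orth M : set H := [set x | forall m, M m -> dot x m = 0].

(* The graph of the operator part A_o of a selfadjoint relation A. *)
Definition oper_part A : set (H * H) :=
  A `&` (orth (mul A) `*` orth (mul A)).

(* The graph of A_o^{1/2}, the nonnegative selfadjoint operator in the
   orthogonal complement of mul A whose square is A_o. *)
Definition sqrt_oper_part A : set (H * H) :=
  xget set0 [set T | [/\ nonneg_selfadjoint_in (orth (mul A)) T,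
                         mul T = [set 0] &
                         (T \; T)%relation = oper_part A]].

(* A[f, g] = (A_o^{1/2} f, A_o^{1/2} g); its diagonal is the quadratic form
   A[f] = `|A_o^{1/2} f| ^+ 2. *)
Definition form_of A : sform H :=
  SForm (dom (sqrt_oper_part A))
        (fun f g => dot (lr_val (sqrt_oper_part A) f)
                        (lr_val (sqrt_oper_part A) g)).

Definition form_eq t s :=
  fdom t = fdom s /\
  forall f g, fdom t f -> fdom t g -> fval t f g = fval s f g.

(* The nonnegative selfadjoint relation associated with a closed nonnegative
   form. *)
Definition lr_of_form t : set (H * H) :=
  xget set0 [set A | nonneg_selfadjoint A /\ form_eq (form_of A) t].

Definition add_form t s : sform H :=
  SForm (fdom t `&` fdom s) (fun f g => fval t f g + fval s f g).

Definition form_sum A B : set (H * H) :=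
  lr_of_form (add_form (form_of A) (form_of B)).

Definition half_form_sum A B : set (H * H) := scale_lr 2^-1 (form_sum A B).

Definition lr_harmonic_mean A B : set (H * H) :=
  ((half_form_sum (A^-1)%relation (B^-1)%relation)^-1)%relation.

(* (A + I)^{-1} *)
Definition resolvent A : set (H * H) := [set (f.2 + f.1, f.1) | f in A].

Definition sr_lim (An : nat -> set (H * H)) : set (H * H) :=
  xget set0 [set A | nonneg_selfadjoint A /\
    forall h : H, lr_val (resolvent (An n)) h @[n --> \oo]
                    --> lr_val (resolvent A) h].

Definition ah_seq A B (n : nat) : set (H * H) * set (H * H) :=
  iter n (fun P => (half_form_sum P.1 P.2, lr_harmonic_mean P.1 P.2)) (A, B).

Definition ah A B : set (H * H) * set (H * H) :=
  (sr_lim (fun n => (ah_seq A B n).1), sr_lim (fun n => (ah_seq A B n).2)).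

(* The sequence [u] in the domain of [t] is t-convergent to [f]. *)
Definition form_cvg t (u : nat -> H) (f : H) :=
  [/\ forall n, fdom t (u n),
      u n @[n --> \oo] --> f &
      fval t (u k.1 - u k.2) (u k.1 - u k.2) @[k --> (\oo, \oo)]
        --> (0 : R[i]^o)].

(* The closure of a closable nonnegative form. *)
Definition form_closure t : sform H :=
  SForm [set f | exists u, form_cvg t u f]
        (fun f g => xget 0 [set c : R[i]^o |
           forall u v, form_cvg t u f -> form_cvg t v g ->
             fval t (u n) (v n) @[n --> \oo] --> c]).

(* s[f, g] = (f', g) for {f, f'}, {g, g'} in S; for a symmetric S this depends
   neither on the choice of f' nor on that of g'. *)
Definition pre_form S : sform H :=
  SForm (dom S) (fun f g => dot (lr_val S f) g).

Definition friedrichs S : set (H * H) := lr_of_form (form_closure (pre_form S)).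

Definition krein S : set (H * H) :=
  ((friedrichs (S^-1)%relation)^-1)%relation.

Definition nonneg_sa_extension S A := nonneg_selfadjoint A /\ S `<=` A.

Definition extremal_extension S A :=
  nonneg_sa_extension S A /\
  forall f, A f ->
    ereal_inf [set (complex.Re (dot (f.2 - g.2) (f.1 - g.1)))%:E | g in S]
      = 0%E.

End LinearRelations.

(* Main.v *)
(* An extension A of S is extremal when dom S is dense in the form domain D[A]
   for the seminorm A[.]^(1/2).  Then A[x] is the supremum of
   2 Re (g', x) - (g', g) over {g, g'} in S, so two extremal extensions have the
   same form on the intersection of their form domains.  Hence half of their
   form sum is again extremal, its form being the common restriction to
   D[A] /\ D[B], and if D[A] is contained in D[B] then half of the form sum of
   A and B is A itself.  Passing to inverses, the harmonic mean h(A, B) is an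
   extremal extension too.  The duality 2 Re (x, y) <= A^{-1}[x] + A[y] shows
   that the form domain of the arithmetic mean lies in that of the harmonic
   mean; therefore a second averaging step changes nothing, and the iteration
   is constant from the first step on.  For A = S_F the first step is already
   trivial, because D[S_F] is contained in every D[A].

   The correspondence between forms and relations rests on one fact: a bounded
   functional on a pre-Hilbert space is represented by a Cauchy sequence. *)

Require Import Defs.
From HB Require Import structures.
From mathcomp Require Import all_boot all_order all_algebra.
From mathcomp Require Import all_classical all_reals all_analysis.
From mathcomp Require Import complex.
From mathcomp Require Import ring lra.

Import Order.TTheory GRing.Theory Num.Theory numFieldNormedType.Exports.

Local Open Scope classical_set_scope.
Local Open Scope ring_scope.
Local Open Scope complex_scope.

Set Implicit Arguments.
Unset Strict Implicit.

(** Since the form of a relation is defined through A_o^{1/2}, chosen by [xget], nothing can be said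
    about it until this root is known to exist. No spectral theorem is used: the root is assembled
    from square roots of the bounded operators T = (A + I)^{-1} and I - T, which come from an
    explicit iteration. All that is extracted from it is [form_ofP]: the form of [A] is closed, and
    [rel_of] recovers [A] from it. Everything afterwards is an argument about closed forms.
    Estimates are made on real parts and real squared norms only. Domains and relations are complex
    subspaces, so imaginary parts are recovered by replacing y with i y. This lets one real Riesz
    lemma serve on several spaces: an orthogonal complement, a form domain, and the graph of a
    relation with a product built from A + I. *)

Section NullSequences.
Variable R : realType.
Implicit Types (a b : nat -> R) (e : R).

(* One-sided: these are only applied to nonnegative quantities. *)
Definition lim0 a := forall e, 0 < e -> exists N, forall n, (N <= n)%N -> a n < e.

Definition cauchy0 (a : nat -> nat -> R) :=
  forall e, 0 < e ->
    exists N, forall n m, (N <= n)%N -> (N <= m)%N -> a n m < e.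

Lemma ler_addeps (x y : R) : (forall e, 0 < e -> x <= y + e) -> x <= y.
Proof. by move=> h; apply/ler_addgt0Pr. Qed.

Lemma lim0_le (c : R) a b :
  0 <= c -> (forall n, a n <= c * b n) -> lim0 b -> lim0 a.
Proof.
move=> c0 ab hb e e0; have c1 : 0 < c + 1 by lra.
have [N hN] := hb (e / (c + 1)) (divr_gt0 e0 c1); exists N => n /hN hn.
apply: le_lt_trans (ab n) _.
have h : c * b n <= c * (e / (c + 1)) by rewrite ler_wpM2l // ltW.
apply: le_lt_trans h _; rewrite mulrA ltr_pdivrMr //; nra.
Qed.

Lemma lim0_leD (c : R) a b b' : 0 <= c ->
  (forall n, a n <= c * (b n + b' n)) -> lim0 b -> lim0 b' -> lim0 a.
Proof.
move=> c0 ab hb hb'; apply: lim0_le c0 ab _ => e e0.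
have e20 : 0 < e / 2 by lra.
have [N hN] := hb _ e20; have [M hM] := hb' _ e20; exists (maxn N M) => n.
by rewrite geq_max => /andP[/hN ? /hM ?]; lra.
Qed.

Lemma lim0D a b : lim0 a -> lim0 b -> lim0 (fun n => a n + b n).
Proof. by apply: (@lim0_leD 1) => // n; rewrite mul1r. Qed.

Lemma lim0_cst (c : R) : lim0 (fun=> c) -> c <= 0.
Proof.
move=> h; apply: ler_addeps => e /h[N /(_ N (leqnn N))]; lra.
Qed.

Lemma cauchy0_lim a (u : nat -> nat -> R) :
  lim0 a -> (forall n m, u n m <= a n + a m) -> cauchy0 u.
Proof.
move=> ha hu e e0; have e20 : 0 < e / 2 by lra.
have [N hN] := ha _ e20; exists N => n m /hN ? /hN ?.
by have := hu n m; lra.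
Qed.

Lemma cauchy0_le (c : R) (u v : nat -> nat -> R) :
  0 <= c -> (forall n m, u n m <= c * v n m) -> cauchy0 v -> cauchy0 u.
Proof.
move=> c0 uv hv e e0; have c1 : 0 < c + 1 by lra.
have [N hN] := hv (e / (c + 1)) (divr_gt0 e0 c1); exists N => n m hn hm.
apply: le_lt_trans (uv n m) _; have {}hN := hN _ _ hn hm.
have h : c * v n m <= c * (e / (c + 1)) by rewrite ler_wpM2l // ltW.
apply: le_lt_trans h _; rewrite mulrA ltr_pdivrMr //; nra.
Qed.

Lemma lim0_sqr_uniq a (x y : R) :
  lim0 (fun n => (a n - x) ^+ 2) -> lim0 (fun n => (a n - y) ^+ 2) -> x = y.
Proof.
move=> hx hy; have : (x - y) ^+ 2 <= 0.
  apply: lim0_cst; apply: (@lim0_leD 2) hx hy => // n.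
  have := sqr_ge0 ((a n - x) + (a n - y)); nra.
by move=> h; apply/eqP; rewrite -subr_eq0 -sqrf_eq0 eq_le h sqr_ge0.
Qed.

Lemma invS_lim0 : lim0 (fun n => n.+1%:R^-1 : R).
Proof.
move=> e e0; have [N _ hN] := @nbhs_infty_gtr R e^-1.
exists N => n Nn; rewrite invf_plt ?posrE ?ltr0Sn //.
have : e^-1 < n%:R :> R by exact: hN.
by move/lt_trans; apply; rewrite ltr_nat.
Qed.

(** The discriminant criterion, without a sign condition on [y]. It converts an inequality stable
    under all real scalings into one of Cauchy-Schwarz type. *)
Lemma discr_le (x d y : R) :
  (forall r, 0 <= x + 2 * r * d + r ^+ 2 * y) -> d ^+ 2 <= x * y.
Proof.
move=> h; have x0 : 0 <= x by have := h 0; lra.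
have [y0|y0|y0] := ltgtP y 0; last first.
- rewrite y0 mulr0; have [->|d0] := eqVneq d 0; first by rewrite expr0n.
  have := h (- (x + 1) / (2 * d)); rewrite y0 mulr0 addr0.
  have -> : x + 2 * (- (x + 1) / (2 * d)) * d = -1 by field.
  lra.
- have := h (- d / y).
  have -> : x + 2 * (- d / y) * d + (- d / y) ^+ 2 * y = x - d ^+ 2 / y.
    by field; rewrite gt_eqF.
  by rewrite subr_ge0 ler_pdivrMr.
- have h1 := h 1; have h2 := h (-1).
  have z0 : 0 < x - y by lra.
  (* For [y < 0] the values at [r] and [- r] add up to twice [x + r ^+ 2 * y]; this [r] is large
     enough to make that negative. *)
  pose r := (x + 1) / (- y) + 1.
  have yr : y * r = - (x + 1) + y by rewrite /r; field; rewrite lt_eqF.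
  have r1 : 1 <= r by rewrite /r lerDr divr_ge0 //; lra.
  have h3 := h r; have h4 := h (- r).
  exfalso; have : 0 <= x + r ^+ 2 * y by lra.
  have -> : r ^+ 2 * y = r * (- (x + 1) + y) by rewrite -yr; ring.
  nra.
Qed.

End NullSequences.

(** * Real semi-inner products and Riesz representation *)

Section SemiInnerProduct.
Variables (R : realType) (X : lmodType R[i]).
Implicit Types (E : set X) (x y z : X).

Definition subspace E :=
  E 0 /\ forall (a : R[i]) x y, E x -> E y -> E (a *: x + y).

Lemma subspaceD {E x y} : subspace E -> E x -> E y -> E (x + y).
Proof. by move=> [_ h] /h/[apply] => /(_ 1); rewrite scale1r. Qed.

Lemma subspaceZ {E} a {x} : subspace E -> E x -> E (a *: x).
Proof. by move=> [E0 h] /h /(_ E0) => /(_ a); rewrite addr0. Qed.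

Lemma subspaceB {E x y} : subspace E -> E x -> E y -> E (x - y).
Proof.
by move=> hE Ex Ey; rewrite -scaleN1r; apply: subspaceD => //; apply: subspaceZ.
Qed.

(** Possibly degenerate and constrained on [E] only, so as to cover real parts of forms on their
    domains and products on graphs. Scalars are real because a real part is not complex-linear. *)
Record semi_inner E (p : X -> X -> R) : Prop := SemiInner {
  sip_sub : subspace E;
  sipDl : forall x y z, E x -> E y -> E z -> p (x + y) z = p x z + p y z;
  sipZl : forall (r : R) x y, E x -> E y -> p (r%:C *: x) y = r * p x y;
  sipC : forall x y, E x -> E y -> p x y = p y x;
  sip_ge0 : forall x, E x -> 0 <= p x x }.

Variables (E : set X) (p : X -> X -> R).
Hypothesis hp : semi_inner E p.
Let hE := sip_sub hp.

Lemma sipBl x y z : E x -> E y -> E z -> p (x - y) z = p x z - p y z.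
Proof.
move=> Ex Ey Ez; have -> : x - y = x + (-1)%:C *: y by rewrite rmorphN1 scaleN1r.
rewrite (sipDl hp) ?(sipZl hp) ?mulN1r //; exact: (subspaceZ _ hE).
Qed.

Lemma sipDr x y z : E x -> E y -> E z -> p x (y + z) = p x y + p x z.
Proof.
move=> Ex Ey Ez; rewrite (sipC hp Ex); last exact: (subspaceD hE).
by rewrite (sipDl hp) // (sipC hp Ey Ex) (sipC hp Ez Ex).
Qed.

Lemma sipBr x y z : E x -> E y -> E z -> p x (y - z) = p x y - p x z.
Proof.
move=> Ex Ey Ez; rewrite (sipC hp Ex); last exact: (subspaceB hE).
by rewrite sipBl // (sipC hp Ey Ex) (sipC hp Ez Ex).
Qed.

Lemma sipZr (r : R) x y : E x -> E y -> p x (r%:C *: y) = r * p x y.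
Proof.
move=> Ex Ey; rewrite (sipC hp Ex); last exact: (subspaceZ _ hE).
by rewrite (sipZl hp) // (sipC hp Ey Ex).
Qed.

Lemma sipDD x y : E x -> E y -> p (x + y) (x + y) = p x x + 2 * p x y + p y y.
Proof.
move=> Ex Ey; have Exy := subspaceD hE Ex Ey.
by rewrite (sipDl hp) // !sipDr // (sipC hp Ey Ex); ring.
Qed.

Lemma sipBB x y : E x -> E y -> p (x - y) (x - y) = p x x - 2 * p x y + p y y.
Proof.
move=> Ex Ey; have Exy := subspaceB hE Ex Ey.
by rewrite sipBl // !sipBr // (sipC hp Ey Ex); ring.
Qed.

Lemma sipBC x y : E x -> E y -> p (x - y) (x - y) = p (y - x) (y - x).
Proof. by move=> Ex Ey; rewrite !sipBB // (sipC hp Ey Ex); ring. Qed.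

Lemma sip_CS x y : E x -> E y -> p x y ^+ 2 <= p x x * p y y.
Proof.
move=> Ex Ey; apply: discr_le => r.
have Ery := subspaceZ r%:C hE Ey.
have := sip_ge0 hp (subspaceD hE Ex Ery).
by rewrite sipDD // sipZr // (sipZl hp) // sipZr //; congr (_ <= _); ring.
Qed.

Lemma sip_young x y : E x -> E y -> 2 * p x y <= p x x + p y y.
Proof.
by move=> Ex Ey; have := sip_ge0 hp (subspaceB hE Ex Ey); rewrite sipBB //; lra.
Qed.

Lemma sip_DD_le x y : E x -> E y -> p (x + y) (x + y) <= 2 * (p x x + p y y).
Proof. by move=> Ex Ey; rewrite sipDD //; have := sip_young Ex Ey; lra. Qed.

Lemma sip_triangle x y z : E x -> E y -> E z ->
  p (x - z) (x - z) <= 2 * (p (x - y) (x - y) + p (y - z) (y - z)).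
Proof.
move=> Ex Ey Ez; have -> : x - z = (x - y) + (y - z) by rewrite addrA subrK.
by apply: sip_DD_le; apply: (subspaceB hE).
Qed.

Lemma sip_lim u w z : (forall n : nat, E (u n)) -> E w -> E z ->
  lim0 (fun n => p (u n - w) (u n - w)) ->
  lim0 (fun n => (p (u n) z - p w z) ^+ 2).
Proof.
move=> Eu Ew Ez; apply: (@lim0_le _ (p z z)); first exact: (sip_ge0 hp).
move=> n; rewrite -sipBl // mulrC; apply: sip_CS => //; exact: (subspaceB hE).
Qed.

Lemma sip_lim_cauchy u w : (forall n : nat, E (u n)) -> E w ->
  lim0 (fun n => p (u n - w) (u n - w)) ->
  cauchy0 (fun n m => p (u n - u m) (u n - u m)).
Proof.
move=> Eu Ew h; apply: (@cauchy0_lim _ (fun n => 2 * p (u n - w) (u n - w))).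
  by apply: (@lim0_le _ 2) h => //; lra.
move=> n m; apply: le_trans (sip_triangle (Eu n) Ew (Eu m)) _.
by rewrite (sipBC Ew (Eu m)); lra.
Qed.

(* Riesz representation by minimising [p x x - 2 l x]; without completeness
   the representing vector is only a Cauchy sequence. *)
Lemma sip_riesz (l : X -> R) (C : R) :
    (forall x y, E x -> E y -> l (x + y) = l x + l y) ->
    (forall r x, E x -> l (r%:C *: x) = r * l x) ->
    0 <= C -> (forall x, E x -> l x ^+ 2 <= C * p x x) ->
  exists u : nat -> X,
    [/\ forall n, E (u n),
        cauchy0 (fun n m => p (u n - u m) (u n - u m)) &
        forall z, E z -> lim0 (fun n => (p (u n) z - l z) ^+ 2)].
Proof.
move=> lD lZ C0 lC; pose J x := p x x - 2 * l x.
pose m := inf [set J x | x in E].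
have Jlb x : E x -> - C <= J x.
  move=> Ex; have := lC x Ex; have p0 := sip_ge0 hp Ex; rewrite /J.
  have [-> h|pn0 h] := eqVneq (p x x) 0.
    have : l x ^+ 2 <= 0 by rewrite mulr0 in h.
    by rewrite le_eqVlt ltNge sqr_ge0 orbF sqrf_eq0 => /eqP ->; lra.
  have p1 : 0 < p x x by rewrite lt_neqAle eq_sym pn0.
  (* By the bound on [l], this product is at least [(p x x - l x) ^+ 2]. *)
  have : 0 <= (p x x - 2 * l x + C) * p x x.
    have := sqr_ge0 (p x x - l x); nra.
  by rewrite pmulr_lge0 //; lra.
have hinf : has_inf [set J x | x in E].
  split; first by exists (J 0), 0 => //; exact: hE.1.
  by exists (- C) => _ [x Ex <-]; exact: Jlb.
have mJ x : E x -> m <= J x.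
  by move=> Ex; apply: ge_inf; [exact: hinf.2 | exists x].
have /choice[u hu] (n : nat) : exists x, E x /\ J x < m + n.+1%:R^-1.
  have [|_ [x Ex <-] h] := @inf_adherent _ _ (n.+1%:R^-1) _ hinf.
    by rewrite invr_gt0 ltr0Sn.
  by exists x.
have Eu n := (hu n).1; have Ju n := (hu n).2; exists u; split => //.
- apply: (@cauchy0_lim _ (fun n => 2 * n.+1%:R^-1)).
    by apply: (@lim0_le _ 2) (@invS_lim0 R) => //; lra.
  (* Parallelogram law: comparison with the midpoint bounds the squared distance of two almost
     minimising vectors by twice the sum of their errors. *)
  move=> n k; have Es := subspaceD hE (Eu n) (Eu k).
  have := mJ _ (subspaceZ (2^-1)%:C hE Es).
  rewrite /J (sipZl hp) ?sipZr //; last exact: (subspaceZ _ hE).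
  rewrite lZ // lD // sipDD // sipBB //; move: (Ju n) (Ju k); rewrite /J.
  by move: (n.+1%:R^-1) (k.+1%:R^-1) => a b; lra.
- move=> z Ez; apply: (@lim0_le _ (p z z)) (@invS_lim0 R); first exact: (sip_ge0 hp).
  move=> n; apply: (@le_trans _ _ ((J (u n) - m) * p z z)); last first.
    by rewrite mulrC ler_wpM2l ?(sip_ge0 hp) // lerBlDl ltW.
  (* Minimality along the line [u n + r z] is quadratic in [r]; its discriminant bounds the failure
     of [u n] to represent [l] at [z]. *)
  apply: discr_le => r; have Erz := subspaceZ r%:C hE Ez.
  have := mJ _ (subspaceD hE (Eu n) Erz).
  rewrite /J sipDD // sipZr // (sipZl hp) // sipZr // lD // lZ //; lra.
Qed.

End SemiInnerProduct.

Section ComplexFacts.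
Variable R : realType.

Lemma Re_add (x y : R[i]) : complex.Re (x + y) = complex.Re x + complex.Re y.
Proof. by case: x; case: y. Qed.

Lemma Re_mulR (r : R) (x : R[i]) : complex.Re (r%:C * x) = r * complex.Re x.
Proof. by case: x => a b /=; rewrite mul0r subr0. Qed.

Lemma Re_conjc (x : R[i]) : complex.Re x^*%C = complex.Re x.
Proof. by case: x. Qed.

Lemma Re_mul_i (x : R[i]) : complex.Re ('i%C * x) = - complex.Im x.
Proof. by case: x => a b /=; rewrite mul0r mul1r add0r. Qed.

Lemma complex_ge0 (x : R[i]) : complex.Im x = 0 -> 0 <= complex.Re x -> 0 <= x.
Proof. by move=> h0 h1; rewrite lecE /= h0 eqxx. Qed.

Lemma complex_eq (x y : R[i]) :
  complex.Re x = complex.Re y -> complex.Im x = complex.Im y -> x = y.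
Proof. by case: x => a b; case: y => c d /= -> ->. Qed.

Lemma complex_gt0 (e : R[i]) : 0 < e -> exists2 r : R, 0 < r & e = r%:C.
Proof.
by case: e => a b; rewrite ltcE /= => /andP[/eqP -> a0]; exists a.
Qed.

End ComplexFacts.

(** * The Hilbert space seen through its real inner product *)

Section HilbertSpace.
Variables (R : realType) (H : completeNormedModType R[i]).
Variable dot : {dot H for (@Num.conj R[i])}.
Hypothesis norm_dot : forall x : H, `|x| ^+ 2 = dot x x.
Implicit Types (x y z : H) (A B S : set (H * H)).

Definition rdot x y : R := complex.Re (dot x y).
Definition nsq x : R := rdot x x.

Lemma dotC x y : dot x y = (dot y x)^*%C.
Proof. by rewrite hermC /= expr0 mul1r. Qed.

Lemma rdotC x y : rdot x y = rdot y x.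
Proof. by rewrite /rdot dotC Re_conjc. Qed.

Lemma rdotDl x y z : rdot (x + y) z = rdot x z + rdot y z.
Proof. by rewrite /rdot linearDl Re_add. Qed.

Lemma rdotZl (r : R) x z : rdot (r%:C *: x) z = r * rdot x z.
Proof. by rewrite /rdot linearZl_LR Re_mulR. Qed.

Lemma rdotiC x y : rdot ('i%C *: x) y = - rdot x ('i%C *: y).
Proof.
rewrite /rdot (dotC x) Re_conjc !linearZl_LR /= !Re_mul_i (dotC x).
by case: (dot y x).
Qed.

Lemma Im_dot x y : complex.Im (dot x y) = rdot x ('i%C *: y).
Proof. by rewrite -[RHS]opprK -rdotiC /rdot linearZl_LR /= Re_mul_i opprK. Qed.

(** By [Im_dot], the imaginary part of (x, y) is the real product of x with i y. *)
Lemma dot_rdot x y z w : rdot x y = rdot z w ->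
  rdot x ('i%C *: y) = rdot z ('i%C *: w) -> dot x y = dot z w.
Proof. by rewrite -!Im_dot; exact: complex_eq. Qed.

Lemma nsq_norm x : nsq x = complex.Re `|x| ^+ 2.
Proof.
rewrite /nsq /rdot -norm_dot expr2 expr2; have := normr_ge0 x.
by case: `|x| => a b; rewrite lecE /= => /andP[/eqP -> _]; rewrite mul0r subr0.
Qed.

Lemma normE x : `|x| = (complex.Re `|x|)%:C.
Proof.
by have := normr_ge0 x; case: `|x| => a b; rewrite lecE /= => /andP[/eqP -> _].
Qed.

Lemma norm_lt x (e : R) : 0 < e -> (`|x| < e%:C) = (nsq x < e ^+ 2).
Proof.
move=> e0; have := normr_ge0 x; rewrite nsq_norm normE ler0c ltcR => x0.
by rewrite ltr_pXn2r // nnegrE // ltW.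
Qed.

Lemma nsq_ge0 x : 0 <= nsq x. Proof. by rewrite nsq_norm sqr_ge0. Qed.

Lemma nsq_eq0 x : nsq x <= 0 -> x = 0.
Proof.
move=> h; apply/eqP; rewrite -normr_eq0 normE.
have : complex.Re `|x| ^+ 2 == 0 by rewrite -nsq_norm eq_le h nsq_ge0.
by rewrite sqrf_eq0 => /eqP ->.
Qed.

Lemma nsqZ (a : R[i]) x :
  nsq (a *: x) = (complex.Re a ^+ 2 + complex.Im a ^+ 2) * nsq x.
Proof.
have aE y z : dot (a *: y) z = a * dot y z by rewrite linearZl_LR.
rewrite /nsq /rdot aE (dotC x (a *: x)) aE; have := dotC x x.
case: a {aE} => b c; case: (dot x x) => p q [] /= e.
have -> : q = 0 by lra.
ring.
Qed.

Lemma rdot_inner : semi_inner setT rdot.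
Proof.
split=> // *; [exact: rdotDl | exact: rdotZl | exact: rdotC | exact: nsq_ge0].
Qed.

Lemma rdotDr x y z : rdot x (y + z) = rdot x y + rdot x z.
Proof. by rewrite !(rdotC x) rdotDl. Qed.

Lemma rdotZr (r : R) x y : rdot x (r%:C *: y) = r * rdot x y.
Proof. by rewrite !(rdotC x) rdotZl. Qed.

Lemma rdotNl x y : rdot (- x) y = - rdot x y.
Proof.
have -> : - x = (-1)%:C *: x by rewrite rmorphN1 scaleN1r.
by rewrite rdotZl mulN1r.
Qed.

Lemma rdotNr x y : rdot x (- y) = - rdot x y.
Proof. by rewrite !(rdotC x) rdotNl. Qed.

Lemma rdotBl x y z : rdot (x - y) z = rdot x z - rdot y z.
Proof. by rewrite rdotDl rdotNl. Qed.

Lemma rdotBr x y z : rdot x (y - z) = rdot x y - rdot x z.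
Proof. by rewrite rdotDr rdotNr. Qed.

Lemma rdot0l x : rdot 0 x = 0.
Proof. by have := rdotBl 0 0 x; rewrite !subrr. Qed.

Lemma rdot0r x : rdot x 0 = 0. Proof. by rewrite rdotC rdot0l. Qed.

Lemma rdot_ext x y : (forall z, rdot x z = rdot y z) -> x = y.
Proof.
move=> h; apply/eqP; rewrite -subr_eq0; apply/eqP/nsq_eq0.
by rewrite /nsq rdotBl h subrr.
Qed.

Definition cvs (u : nat -> H) x := lim0 (fun n => nsq (u n - x)).

Lemma cvsP (u : nat -> H) x : (u n @[n --> \oo] --> x) <-> cvs u x.
Proof.
split=> [/cvgrPdist_lt h e e0|h].
  have s0 : 0 < Num.sqrt e by rewrite sqrtr_gt0.
  have /h[N _ hN] : 0 < (Num.sqrt e)%:C :> R[i] by rewrite ltcR.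
  exists N => n /hN /=; rewrite distrC norm_lt // sqr_sqrtr //; exact: ltW.
apply/cvgrPdist_lt => _ /complex_gt0[e e0 ->].
have [N hN] := h _ (exprn_gt0 2 e0); exists N => // n /hN /=.
by rewrite distrC norm_lt.
Qed.

Lemma cvs_complete (u : nat -> H) :
  cauchy0 (fun n m => nsq (u n - u m)) -> exists x, cvs u x.
Proof.
move=> h; have /cauchy_cvg hu : cauchy (u n @[n --> \oo]).
  apply: cauchy_exP => _ /complex_gt0[e e0 ->].
  have [N hN] := h _ (exprn_gt0 2 e0); exists (u N).
  exists N => // n /= Nn; rewrite -ball_normE /= norm_lt //.
  exact: hN.
by exists (lim (u n @[n --> \oo])); apply/cvsP.
Qed.

Lemma cvs_uniq (u : nat -> H) x y : cvs u x -> cvs u y -> x = y.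
Proof.
move=> hx hy; apply: rdot_ext => z.
by apply: lim0_sqr_uniq; apply: (sip_lim rdot_inner) => //; eassumption.
Qed.

Lemma cvs_rdot (u : nat -> H) x z :
  cvs u x -> lim0 (fun n => (rdot (u n) z - rdot x z) ^+ 2).
Proof. exact: (sip_lim rdot_inner). Qed.

Lemma cvsD (u v : nat -> H) x y :
  cvs u x -> cvs v y -> cvs (fun n => u n + v n) (x + y).
Proof.
apply: (@lim0_leD _ 2) => // n; rewrite opprD addrACA.
exact: (sip_DD_le rdot_inner).
Qed.

(** The real identity at i f is the imaginary part of the identity at f, and [A] contains i f along
    with f. *)
Lemma adjointP A g : subspace A ->
  adjoint dot A g <-> forall f, A f -> rdot f.2 g.1 = rdot f.1 g.2.
Proof.
move=> hA; split=> [h f /h|h f Af]; first by rewrite /rdot => ->.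
apply: dot_rdot; first exact: h.
by apply/oppr_inj; rewrite -!rdotiC; exact: h (subspaceZ 'i%C hA Af).
Qed.

Lemma adjoint_seq_closed A (u : nat -> H * H) f : subspace A ->
  (forall n, adjoint dot A (u n)) -> cvs (fun n => (u n).1) f.1 ->
  cvs (fun n => (u n).2) f.2 -> adjoint dot A f.
Proof.
move=> hA hu h1 h2; apply/adjointP => // g Ag.
apply: lim0_sqr_uniq; first by rewrite rdotC; exact: cvs_rdot h1.
have hu' n : rdot (u n).1 g.2 = rdot (u n).2 g.1.
  by rewrite rdotC [RHS]rdotC; have /adjointP -> := hu n.
rewrite rdotC.
by have := cvs_rdot g.1 h2; under eq_fun do rewrite -hu'.
Qed.

Lemma adjoint_closed A : subspace A -> closed (adjoint dot A).
Proof.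
move=> hA f hf.
have /choice[u hu] (n : nat) : exists g, adjoint dot A g /\
    (nsq (g.1 - f.1) < n.+1%:R^-1 /\ nsq (g.2 - f.2) < n.+1%:R^-1).
  have n0 : 0 < Num.sqrt (n.+1%:R^-1 : R) by rewrite sqrtr_gt0 invr_gt0 ltr0Sn.
  have n1 : 0 < (Num.sqrt (n.+1%:R^-1 : R))%:C by rewrite ltcR.
  have [g [Ag []]] := hf _ (nbhsx_ballx f _ n1).
  rewrite -!ball_normE /= !(distrC f.1, distrC f.2) !norm_lt //.
  by rewrite sqr_sqrtr ?invr_ge0 // => h1 h2; exists g.
by apply: (@adjoint_seq_closed _ u) => //; first (by move=> n; case: (hu n));
  apply: (@lim0_le _ 1) (@invS_lim0 R) => // n; rewrite mul1r ltW //;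
  case: (hu n) => _ [].
Qed.

End HilbertSpace.

(** * Selfadjoint relations and the representation theorem for closed forms *)

Section SelfadjointRelations.
Variables (R : realType) (H : completeNormedModType R[i]).
Variable dot : {dot H for (@Num.conj R[i])}.
Hypothesis norm_dot : forall x : H, `|x| ^+ 2 = dot x x.
Local Notation rdot := (rdot dot).
Local Notation nsq := (nsq dot).
Local Notation cvs := (cvs dot).
Implicit Types (x y z : H) (A B S : set (H * H)) (t s : sform H).

(** The working version of [nonneg_selfadjoint]: real parts only, with closedness recovered from
    [nsa_adj], an adjoint being closed. *)
Record nsa A : Prop := Nsa {
  nsa_sub : subspace A;
  nsa_adj : adjoint dot A = A;
  nsa_ge0 : forall f, A f -> 0 <= rdot f.2 f.1 }.

Lemma nsaP A : nonneg_selfadjoint dot A <-> nsa A.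
Proof.
rewrite /nonneg_selfadjoint /nonneg_selfadjoint_in.
have -> : adjoint dot A `&` (setT `*` setT) = adjoint dot A.
  by apply/seteqP; split=> [f []|f h].
split=> [[[A0 AP Ac] Aadj A_ge0]|[hA Aadj A_ge0]].
  split=> // f /A_ge0; rewrite lecE => /andP[_]; exact.
split=> //.
  by split; [exact: hA.1 | exact: hA.2 | rewrite -Aadj; exact: adjoint_closed].
move=> f Af; apply: complex_ge0; last exact: A_ge0.
have : dot f.2 f.1 = dot f.1 f.2 by move: (Af); rewrite -{1}Aadj => /(_ f Af).
rewrite (dotC _ f.1); case: (dot f.2 f.1) => a b [] /=; lra.
Qed.

Lemma nsa_mem A f :
  nsa A -> (forall g, A g -> rdot g.2 f.1 = rdot g.1 f.2) -> A f.
Proof.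
by move=> [hA Aadj _] h; rewrite -Aadj; apply/adjointP.
Qed.

Lemma nsa_sym A f g : nsa A -> A f -> A g -> rdot g.2 f.1 = rdot g.1 f.2.
Proof.
by move=> [hA Aadj _]; rewrite -{1}Aadj => /(adjointP _ _ hA); apply.
Qed.

(** Riesz on the graph of [A] with the product ((A + I)f, (A + I)g). Nonnegativity bounds both
    components of a pair by this norm, so the representing Cauchy sequence converges in the closed
    relation [A]. *)
Lemma nsa_range A h : nsa A -> exists2 f, A f & f.1 + f.2 = h.
Proof.
move=> nA; have hA := nsa_sub nA.
pose T (f : H * H) := f.1 + f.2; pose p f g := rdot (T f) (T g).
have TD f g : T (f + g) = T f + T g by rewrite /T /= addrACA.
have TZ a f : T (a *: f) = a *: T f by rewrite /T /= scalerDr.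
have hp : semi_inner A p.
  split=> // *; rewrite /p ?TD ?TZ; [exact: rdotDl|exact: rdotZl|exact: rdotC|].
  exact: nsq_ge0.
have le12 f : A f -> nsq f.1 <= p f f /\ nsq f.2 <= p f f.
  move=> /(nsa_ge0 nA); rewrite /p /T rdotDl !rdotDr (rdotC _ f.1 f.2).
  by have := nsq_ge0 norm_dot f.1; have := nsq_ge0 norm_dot f.2; rewrite /nsq; lra.
have [||||u [Au cu lu]] := sip_riesz hp (l := fun f => rdot h (T f)) (C := nsq h).
- by move=> f g _ _; rewrite TD rdotDr.
- by move=> r f _; rewrite TZ rdotZr.
- exact: nsq_ge0.
- by move=> f _; apply: (sip_CS (rdot_inner norm_dot)).
have [|f1 h1] := @cvs_complete _ _ _ norm_dot (fun n => (u n).1).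
  apply: (@cauchy0_le _ 1) cu => // n m; rewrite mul1r.
  exact: (le12 _ (subspaceB hA (Au n) (Au m))).1.
have [|f2 h2] := @cvs_complete _ _ _ norm_dot (fun n => (u n).2).
  apply: (@cauchy0_le _ 1) cu => // n m; rewrite mul1r.
  exact: (le12 _ (subspaceB hA (Au n) (Au m))).2.
have Af : A (f1, f2).
  rewrite -(nsa_adj nA); apply: (@adjoint_seq_closed _ _ _ norm_dot _ u) => // n.
  by rewrite (nsa_adj nA).
have hz g : A g -> rdot (f1 + f2) (T g) = rdot h (T g).
  move=> Ag; apply: lim0_sqr_uniq (lu g Ag).
  by apply: cvs_rdot => //; exact: cvsD.
(* The residual is orthogonal to the range of A + I, which puts [(k, - k)] into the adjoint, that is
   into [A]; nonnegativity then forces [k = 0]. *)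
pose k := h - (f1 + f2).
have Ak : A (k, - k).
  apply: nsa_mem => // g /hz hg /=; apply/eqP; rewrite -subr_eq0 rdotNr opprK.
  by rewrite -rdotDl addrC rdotC /k rdotBl -hg subrr.
have := nsa_ge0 nA Ak; rewrite /= rdotNl oppr_ge0 => /(nsq_eq0 norm_dot) k0.
by exists (f1, f2) => //=; apply/eqP; rewrite eq_sym -subr_eq0; apply/eqP.
Qed.

(** Given g in the adjoint, choose f in [A] with the same image under A + I. Testing against the
    whole range shows that g and f agree. *)
Lemma nsa_of_range A : subspace A ->
    (forall f g, A f -> A g -> rdot g.2 f.1 = rdot g.1 f.2) ->
    (forall f, A f -> 0 <= rdot f.2 f.1) ->
    (forall h, exists2 f, A f & f.1 + f.2 = h) -> nsa A.
Proof.
move=> hA sA pA rA; split=> //; apply/seteqP; split=> [g|f Af]; last first.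
  by apply/adjointP => // g; exact: sA.
move=> /(adjointP _ _ hA) hg; have [f Af fg] := rA (g.1 + g.2).
have e1 : g.1 = f.1.
  apply: (rdot_ext norm_dot) => z; have [a Aa <-] := rA z.
  have := hg _ Aa; have := sA _ _ Af Aa.
  have : rdot a.1 f.1 + rdot a.1 f.2 = rdot a.1 g.1 + rdot a.1 g.2.
    by rewrite -!rdotDr fg.
  by rewrite (rdotC _ g.1) (rdotC _ f.1) !rdotDl; lra.
have e2 : g.2 = f.2 by apply/(addrI f.1); rewrite fg e1.
by move: Af; rewrite (surjective_pairing f) -e1 -e2 -surjective_pairing.
Qed.

Lemma nsa_inv A : nsa A -> nsa (A^-1)%relation.
Proof.
move=> nA; have [A0 AP] := nsa_sub nA; apply: nsa_of_range => /=.
- by split=> // a x y Ax Ay; exact: (AP a _ _ Ax Ay).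
- by move=> f g Af Ag; rewrite -(nsa_sym nA Af Ag).
- by move=> f Af; rewrite rdotC; exact: (nsa_ge0 nA Af).
- move=> h; have [f Af <-] := nsa_range h nA.
  by exists (f.2, f.1); rewrite /= -?surjective_pairing // addrC.
Qed.

Definition rval t (x y : H) : R := complex.Re (fval t x y).

Record closed_form t : Prop := ClosedForm {
  cf_sub : subspace (fdom t);
  cf_lin : forall a x y z, fdom t x -> fdom t y -> fdom t z ->
    fval t (a *: x + y) z = a * fval t x z + fval t y z;
  cf_herm : forall x y, fdom t x -> fdom t y -> fval t x y = (fval t y x)^*%C;
  cf_ge0 : forall x, fdom t x -> 0 <= rval t x x;
  cf_complete : forall (u : nat -> H) x, (forall n, fdom t (u n)) -> cvs u x ->
    cauchy0 (fun n m => rval t (u n - u m) (u n - u m)) ->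
    fdom t x /\ lim0 (fun n => rval t (u n - x) (u n - x)) }.

Lemma fvalZ t (a : R[i]) x y : closed_form t -> fdom t x -> fdom t y ->
  fval t (a *: x) y = a * fval t x y.
Proof.
move=> ct Dx Dy; have D0 := (cf_sub ct).1.
have h0 : fval t 0 y = 0.
  have := cf_lin ct 1 D0 D0 Dy; rewrite scaler0 addr0 mul1r.
  by move/eqP; rewrite eq_sym addrC -subr_eq0 addrK => /eqP.
by rewrite -[_ *: x]addr0 (cf_lin ct) // h0 addr0.
Qed.

Lemma form_inner t : closed_form t -> semi_inner (fdom t) (rval t).
Proof.
move=> ct; have hD := cf_sub ct; split=> // [x y z|r x y|x y|x].
- by move=> *; rewrite /rval -{1}[x]scale1r (cf_lin ct) // mul1r Re_add.
- by move=> Dx Dy; rewrite /rval fvalZ // Re_mulR.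
- move=> Dx Dy; rewrite /rval (cf_herm ct Dx Dy) Re_conjc //.
- exact: (cf_ge0 ct).
Qed.

Lemma Im_fval t x y : closed_form t -> fdom t x -> fdom t y ->
  complex.Im (fval t x y) = rval t x ('i%C *: y).
Proof.
move=> ct Dx Dy; have hD := cf_sub ct.
rewrite /rval (cf_herm ct Dx (subspaceZ 'i%C hD Dy)) Re_conjc fvalZ // Re_mul_i.
by rewrite (cf_herm ct Dx Dy); case: (fval t y x).
Qed.

Lemma rvalZZ t (a : R[i]) x : closed_form t -> fdom t x ->
  rval t (a *: x) (a *: x) =
    (complex.Re a ^+ 2 + complex.Im a ^+ 2) * rval t x x.
Proof.
move=> ct Dx; have Dax := subspaceZ a (cf_sub ct) Dx; have := cf_herm ct Dx Dx.
rewrite /rval fvalZ // (cf_herm ct Dx Dax) fvalZ //.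
case: a {Dax} => b c; case: (fval t x x) => p q [] /= e.
have -> : q = 0 by lra.
ring.
Qed.

Lemma semi_innerD (X : lmodType R[i]) (E F : set X) p q :
  semi_inner E p -> semi_inner F q ->
  semi_inner (E `&` F) (fun v w => p v w + q v w).
Proof.
move=> hp hq; split=> [|x y z [? ?] [? ?] [? ?]|r x y [? ?] [? ?]|x y [? ?] [? ?]|x [? ?]].
- split; first by split; [exact: (sip_sub hp).1|exact: (sip_sub hq).1].
  move=> a x y [? ?] [? ?].
  by split; [exact: (sip_sub hp).2|exact: (sip_sub hq).2].
- by rewrite (sipDl hp) // (sipDl hq) // addrACA.
- by rewrite (sipZl hp) // (sipZl hq) // mulrDr.
- by rewrite (sipC hp) // (sipC hq).
- by rewrite addr_ge0 ?(sip_ge0 hp) ?(sip_ge0 hq).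
Qed.

Lemma form_inner1 t : closed_form t ->
  semi_inner (fdom t) (fun x y => rval t x y + rdot x y).
Proof.
move=> /form_inner ht; have := semi_innerD ht (rdot_inner norm_dot).
by rewrite setIT.
Qed.

(** The relation of the first representation theorem. The domain need not be dense: f' is determined
    up to the orthogonal complement of [fdom t], which becomes the multivalued part. *)
Definition rel_of t : set (H * H) :=
  [set f | fdom t f.1 /\ forall x, fdom t x -> rval t f.1 x = rdot f.2 x].

(** By [nsa_of_range] only the range is at issue: Riesz for (h, .) in the form norm gives a sequence
    with limit w in the domain, and the pair sought is [(w, h - w)]. *)
Lemma rel_of_nsa t : closed_form t -> nsa (rel_of t).
Proof.
move=> ct; have ht := form_inner ct; have h1 := form_inner1 ct.
have hD := cf_sub ct; apply: nsa_of_range.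
- split=> [|a f g [Df hf] [Dg hg]].
    split=> [|x Dx /=]; first exact: hD.1.
    by have := sipBl ht hD.1 hD.1 Dx; rewrite !subrr /= rdot0l.
  split=> [|x Dx]; first exact: hD.2.
  suff fi z : fdom t z -> fval t f.1 z = dot f.2 z /\ fval t g.1 z = dot g.2 z.
    have [e1 e2] := fi x Dx.
    by rewrite /rval (cf_lin ct) // e1 e2 /rdot /= linearPl.
  move=> Dz; have Diz := subspaceZ 'i%C hD Dz; split; apply: complex_eq.
  + exact: hf.
  + by rewrite Im_fval // hf // Im_dot.
  + exact: hg.
  + by rewrite Im_fval // hg // Im_dot.
- move=> f g [Df hf] [Dg hg].
  by rewrite -hg // (sipC ht) // hf // rdotC.
- by move=> f [Df hf]; rewrite -hf //; exact: cf_ge0.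
move=> h.
have [||||u [Du cu lu]] := sip_riesz h1 (l := rdot h) (C := nsq h).
- by move=> *; rewrite rdotDr.
- by move=> *; rewrite rdotZr.
- exact: nsq_ge0.
- move=> x Dx; apply: le_trans (sip_CS (rdot_inner norm_dot) _ _) _ => //.
  rewrite ler_wpM2l ?(nsq_ge0 norm_dot) // lerDr; exact: (cf_ge0 ct).
have DB n m := subspaceB hD (Du n) (Du m).
have [|w cw] := @cvs_complete _ _ _ norm_dot u.
  apply: (@cauchy0_le _ 1) cu => // n m; rewrite mul1r lerDr.
  exact: (cf_ge0 ct).
have [|Dw lw] := cf_complete ct Du cw.
  apply: (@cauchy0_le _ 1) cu => // n m; rewrite mul1r lerDl.
  exact: nsq_ge0.
exists (w, h - w); last by rewrite /= addrC subrK.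
split=> //= x Dx.
rewrite rdotBl; have h3 := sip_lim h1 Du Dw Dx (lim0D lw cw).
have := lim0_sqr_uniq h3 (lu x Dx); lra.
Qed.

(** A membership test for form domains: x belongs as soon as (x, (A + I)f) is bounded by the energy
    ((A + I)f, f). It yields both the density of the relation in its form domain and the domain
    inclusion for the harmonic mean. *)
Lemma rel_of_core t x (C : R) : closed_form t -> 0 <= C ->
    (forall f, rel_of t f -> rdot x (f.1 + f.2) ^+ 2 <= C * rdot (f.1 + f.2) f.1) ->
  fdom t x /\ exists u : nat -> H * H,
    [/\ forall n, rel_of t (u n), cvs (fun n => (u n).1) x &
        lim0 (fun n => rval t ((u n).1 - x) ((u n).1 - x))].
Proof.
move=> ct C0 hC; have nA := rel_of_nsa ct; have hA := nsa_sub nA.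
pose A := rel_of t; pose p (f g : H * H) := rdot (f.1 + f.2) g.1.
have hp : semi_inner A p.
  split=> // [f g k _ _ _|r f g _ _|f g Af Ag|f Af]; rewrite /p /=.
  - by rewrite !rdotDl; ring.
  - by rewrite -scalerDr rdotZl.
  - by rewrite !rdotDl (nsa_sym nA Af Ag) !(rdotC _ g.1).
  - by rewrite rdotDl addr_ge0 ?(nsq_ge0 norm_dot) //; exact: (nsa_ge0 nA).
have [||||u [Au cu lu]] := sip_riesz hp (l := fun f => rdot x (f.1 + f.2)) (C := C).
- by move=> f g _ _; rewrite -rdotDr addrACA.
- by move=> r f _; rewrite /= -scalerDr rdotZr.
- by [].
- exact: hC.
have pE f : A f -> p f f = nsq f.1 + rval t f.1 f.1.
  by move=> [Df hf]; rewrite hf // /p rdotDl.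
have AB n m := subspaceB hA (Au n) (Au m).
have [|w cw] := @cvs_complete _ _ _ norm_dot (fun n => (u n).1).
  apply: (@cauchy0_le _ 1) cu => // n m; rewrite mul1r (pE _ (AB n m)) lerDl.
  by apply: (cf_ge0 ct); case: (AB n m).
have [|Dw lw] := cf_complete ct (fun n => (Au n).1) cw.
  apply: (@cauchy0_le _ 1) cu => // n m; rewrite mul1r (pE _ (AB n m)) lerDr.
  exact: nsq_ge0.
(* Both vectors have the same products with the range of A + I, which is the whole space. *)
suff -> : x = w by split=> //; exists u.
apply: (rdot_ext norm_dot) => z; have [g Ag <-] := nsa_range z nA.
apply: lim0_sqr_uniq (lu g Ag) _ => /=.
have pg n : p (u n) g = rdot (u n).1 (g.1 + g.2).
  by rewrite (sipC hp) // /p rdotC.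
by under eq_fun do rewrite pg; exact: cvs_rdot.
Qed.

Lemma rel_of_dense t x : closed_form t -> fdom t x ->
  exists u : nat -> H * H,
    [/\ forall n, rel_of t (u n), cvs (fun n => (u n).1) x &
        lim0 (fun n => rval t ((u n).1 - x) ((u n).1 - x))].
Proof.
move=> ct Dx; have h1 := form_inner1 ct.
apply: (rel_of_core (C := rval t x x + nsq x) ct (sip_ge0 h1 Dx) _).2.
move=> f [Df hf]; have := sip_CS h1 Dx Df.
rewrite rdotDl -hf // rdotDr (rdotC _ x f.2) -hf // (sipC (form_inner ct) Dx Df).
by rewrite [rdot x _ + _]addrC [rdot f.1 _ + _]addrC.
Qed.

(** A closed form is determined by its relation: on the relation both forms are read off from f',
    and the approximation of [rel_of_dense] carries this to the rest of the domain. *)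
Lemma rel_of_incl t s x : closed_form t -> closed_form s ->
    rel_of t = rel_of s -> fdom t x ->
  fdom s x /\ forall y, fdom t y -> fdom s y -> rval t x y = rval s x y.
Proof.
move=> ct cs ts Dx; have [u [Au cu lu]] := rel_of_dense ct Dx.
have As n : rel_of s (u n) by rewrite -ts.
have AB n m := subspaceB (nsa_sub (rel_of_nsa ct)) (Au n) (Au m).
have [|Dsx lsu] := cf_complete cs (fun n => (As n).1) cu.
  have := sip_lim_cauchy (form_inner ct) (fun n => (Au n).1) Dx lu.
  apply: (@cauchy0_le _ 1) => // n m; rewrite mul1r.
  have := AB n m; rewrite ts => -[Ds hs]; have [Dt ht] := AB n m.
  by rewrite -[_ - _]/((u n - u m).1) hs // ht.
split=> // y Dt Ds.
have h1 := sip_lim (form_inner ct) (fun n => (Au n).1) Dx Dt lu.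
have h2 := sip_lim (form_inner cs) (fun n => (As n).1) Dsx Ds lsu.
apply: lim0_sqr_uniq h1 _.
have e n : rval t (u n).1 y = rval s (u n).1 y.
  by rewrite (Au n).2 // (As n).2.
by under eq_fun do rewrite e.
Qed.

Lemma form_eq_rval t s : closed_form t -> closed_form s -> fdom t = fdom s ->
  (forall x y, fdom t x -> fdom t y -> rval t x y = rval s x y) -> form_eq t s.
Proof.
move=> ct cs e h; split=> // x y Dx Dy; apply: complex_eq; first exact: h.
have Diy := subspaceZ 'i%C (cf_sub ct) Dy.
by rewrite !Im_fval -?e // h.
Qed.

Lemma form_eq_rel_of t s : closed_form t -> closed_form s ->
  rel_of t = rel_of s -> form_eq t s.
Proof.
move=> ct cs ts; have e : fdom t = fdom s.
  apply/seteqP; split=> x Dx; first exact: (rel_of_incl ct cs ts Dx).1.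
  exact: (rel_of_incl cs ct (esym ts) Dx).1.
apply: form_eq_rval => // x y Dx Dy.
by apply: (rel_of_incl ct cs ts Dx).2; rewrite // -e.
Qed.

Lemma rel_of_form_eq t s : form_eq t s -> rel_of t = rel_of s.
Proof.
move=> [e h]; rewrite /rel_of -e; apply/seteqP.
by split=> f [Df hf]; split=> // x Dx; rewrite -hf // /rval h.
Qed.

End SelfadjointRelations.

(** * Square root of I - K for a symmetric contraction K *)

Section SquareRootOfContraction.
Variables (R : realType) (H : completeNormedModType R[i]).
Variable dot : {dot H for (@Num.conj R[i])}.
Hypothesis norm_dot : forall x : H, `|x| ^+ 2 = dot x x.
Local Notation rdot := (rdot dot).
Local Notation nsq := (nsq dot).
Local Notation cvs := (cvs dot).
Implicit Types (x y z : H) (C K : H -> H).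

Definition nm x : R := complex.Re `|x|.

Lemma nm_ge0 x : 0 <= nm x.
Proof. by rewrite -ler0c -[(nm x)%:C]normE. Qed.

Lemma nmD x y : nm (x + y) <= nm x + nm y.
Proof. by rewrite -lecR rmorphD /= /nm -!normE ler_normD. Qed.

Lemma nmZ (a : R[i]) x : nm (a *: x) = complex.Re `|a| * nm x.
Proof.
rewrite /nm normrZ; have := normr_ge0 a; case: `|a| => b c.
by rewrite lecE /= => /andP[/eqP -> _]; case: `|x| => d e /=; rewrite mul0r subr0.
Qed.

Lemma nsq_nm x : nsq x = nm x ^+ 2. Proof. exact: nsq_norm. Qed.

Lemma nmZR (r : R) x : 0 <= r -> nm (r%:C *: x) = r * nm x.
Proof. by move=> r0; rewrite nmZ ger0_norm ?ler0c. Qed.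

Lemma cvsZ (a : R[i]) (u : nat -> H) x : cvs u x -> cvs (fun n => a *: u n) (a *: x).
Proof.
apply: (@lim0_le _ (complex.Re `|a| ^+ 2)); first exact: sqr_ge0.
by move=> n; rewrite -scalerBr !nsq_nm nmZ exprMn.
Qed.

Record contraction C : Prop := Contraction {
  ctr_lin : forall (a : R[i]) x y, C (a *: x + y) = a *: C x + C y;
  ctr_le : forall x, nsq (C x) <= nsq x }.

Definition symmetric_op C := forall x y, rdot (C x) y = rdot x (C y).

Lemma linD C : (forall (a : R[i]) x y, C (a *: x + y) = a *: C x + C y) ->
  forall x y, C (x + y) = C x + C y.
Proof. by move=> h x y; rewrite -{1}[x]scale1r h scale1r. Qed.

Lemma linB C : (forall (a : R[i]) x y, C (a *: x + y) = a *: C x + C y) ->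
  forall x y, C (x - y) = C x - C y.
Proof. by move=> h x y; rewrite addrC -scaleN1r h scaleN1r addrC. Qed.

Lemma linZ C : (forall (a : R[i]) x y, C (a *: x + y) = a *: C x + C y) ->
  forall a x, C (a *: x) = a *: C x.
Proof.
move=> h a x; have C0 : C 0 = 0 by rewrite -(subrr x) (linB h) !subrr.
by rewrite -[a *: x]addr0 h C0 addr0.
Qed.

Lemma ctr_cvs C (u : nat -> H) x :
  contraction C -> cvs u x -> cvs (C \o u) (C x).
Proof.
move=> [Cl Cle]; apply: (@lim0_le _ 1) => // n.
by rewrite mul1r /= -(linB Cl).
Qed.

Lemma ctr_form_le C x : contraction C -> rdot (C x) x <= nsq x.
Proof.
move=> [_ Cle]; have h := sip_young (rdot_inner norm_dot) (x := C x) (y := x) I I.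
have := Cle x; rewrite /nsq in h *; lra.
Qed.

Variable K : H -> H.
Hypotheses (cK : contraction K) (sK : symmetric_op K).

(* [sqrt_iter n] increases to 1 - (1 - K)^{1/2}: all these operators are
   polynomials in K with nonnegative coefficients, so the scalar iteration
   [sqrt_coef] at K = 1 controls the norms of the increments. *)
Fixpoint sqrt_iter n x : H :=
  if n is m.+1 then (2^-1)%:C *: (K x + sqrt_iter m (sqrt_iter m x)) else 0.

Fixpoint sqrt_coef n : R :=
  if n is m.+1 then 2^-1 * (1 + sqrt_coef m ^+ 2) else 0.

Local Notation Y := sqrt_iter.
Local Notation c := sqrt_coef.

Lemma sqrt_iter_lin n (a : R[i]) x y : Y n (a *: x + y) = a *: Y n x + Y n y.
Proof.
elim: n a x y => [|n IH] a x y /=; first by rewrite scaler0 addr0.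
rewrite (ctr_lin cK) !IH !scalerA [a * _]mulrC -scalerA -scalerDr; congr (_ *: _).
by rewrite scalerDr addrACA.
Qed.

Lemma sqrt_iter_sym n : symmetric_op (Y n).
Proof.
elim: n => [|n IH] x y /=; first by rewrite rdot0l rdot0r.
by rewrite rdotZl rdotZr rdotDl rdotDr sK !IH.
Qed.

Lemma sqrt_iter_comm n C : contraction C -> (forall x, C (K x) = K (C x)) ->
  forall x, C (Y n x) = Y n (C x).
Proof.
move=> [Cl _] CK; elim: n => [|n IH] x /=.
  by rewrite -(subrr x) (linB Cl) !subrr.
by rewrite (linZ Cl) (linD Cl) CK !IH.
Qed.

(** With b = 1 - c the recursion is b -> b - b^2 / 2, whose iterates decay like 2 / n. The induction
    splits on whether b already meets the next bound. *)
Lemma sqrt_coef_le n : 0 <= c n /\ 1 - c n <= 2 * n.+1%:R^-1.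
Proof.
elim: n => [|n [IH0 IH]] /=; first by rewrite invr1; split; lra.
split; first by have := sqr_ge0 (c n); lra.
have [c1|c1] := leP 1 (c n).
  have : 0 <= n.+2%:R^-1 :> R by rewrite invr_ge0.
  by move: (n.+2%:R^-1) => e; nra.
have n0 : 0 < n.+1%:R :> R by rewrite ltr0Sn.
have h : (1 - c n) * n.+1%:R <= 2 by rewrite -ler_pdivlMr.
rewrite ler_pdivlMr ?ltr0Sn // -[n.+2]addn1 natrD.
move: (n.+1%:R) n0 h => k k0 h.
have -> : 1 - 2^-1 * (1 + c n ^+ 2) = (1 - c n) - (1 - c n) ^+ 2 / 2 by field.
have : 0 < 1 - c n by lra.
move: (1 - c n) h => b h b0.
have [kc|kc] := leP (b * (k + 1)) 2.
  have : 0 <= b ^+ 2 * (k + 1) by rewrite mulr_ge0 ?sqr_ge0 //; lra.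
  lra.
have : b * 2 <= b * (b * (k + 1)) by rewrite ler_pM2l // ltW.
lra.
Qed.

Lemma sqrt_coef_le1 n : c n <= 1.
Proof.
elim: n => [|n IH] /=; first exact: ler01.
by have [? _] := sqrt_coef_le n; nra.
Qed.

Lemma sqrt_coef_incr n : c n <= c n.+1.
Proof. by rewrite /=; have := sqr_ge0 (1 - c n); lra. Qed.

Lemma sqrt_iter_le n x : nm (Y n x) <= c n * nm x.
Proof.
elim: n x => [|n IH] x.
  by rewrite /= mul0r /nm normr0.
have [c0 _] := sqrt_coef_le n.
rewrite /= nmZR ?invr_ge0 // -mulrA ler_wpM2l ?invr_ge0 //.
apply: le_trans (nmD _ _) _; rewrite mulrDl mul1r lerD //.
  rewrite -ler_sqr ?nnegrE ?nm_ge0 // -!nsq_nm; exact: (ctr_le cK).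
apply: le_trans (IH _) _; rewrite expr2 -mulrA ler_wpM2l //.
Qed.

(** The difference of squares is split as Y'(Y' - Y) + (Y' - Y)Y, which requires no commutation and
    bounds the increment exactly as in the scalar recursion. *)
Lemma sqrt_iter_incr n x : nm (Y n.+1 x - Y n x) <= (c n.+1 - c n) * nm x.
Proof.
elim: n x => [|n IH] x.
  rewrite subr0 /= subr0; exact: (sqrt_iter_le 1).
have [c0 _] := sqrt_coef_le n; have [c1 _] := sqrt_coef_le n.+1.
have ci := sqrt_coef_incr n; have x0 := nm_ge0 x.
set y1 := Y n.+1; set y0 := Y n.
have -> : Y n.+2 x - y1 x =
    (2^-1)%:C *: (y1 (y1 x - y0 x) + (y1 (y0 x) - y0 (y0 x))).
  have -> : y1 (y1 x - y0 x) = y1 (y1 x) - y1 (y0 x).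
    exact: (linB (sqrt_iter_lin n.+1)).
  have e2 : Y n.+2 x = (2^-1)%:C *: (K x + y1 (y1 x)) by [].
  have e1 : y1 x = (2^-1)%:C *: (K x + y0 (y0 x)) by [].
  rewrite addrA subrK e2 [X in _ - X = _]e1 -scalerBr; congr (_ *: _).
  by rewrite opprD addrACA subrr add0r.
rewrite nmZR ?invr_ge0 //.
have h1 : nm (y1 (y1 x - y0 x)) <= c n.+1 * ((c n.+1 - c n) * nm x).
  by apply: le_trans (sqrt_iter_le _ _) _; rewrite ler_wpM2l.
have h2 : nm (y1 (y0 x) - y0 (y0 x)) <= (c n.+1 - c n) * (c n * nm x).
  apply: le_trans (IH _) _; rewrite ler_wpM2l ?subr_ge0 //; exact: sqrt_iter_le.
have h3 := nmD (y1 (y1 x - y0 x)) (y1 (y0 x) - y0 (y0 x)).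
have -> : c n.+2 - c n.+1 = 2^-1 * (c n.+1 ^+ 2 - c n ^+ 2) by rewrite /=; lra.
by rewrite -mulrA ler_wpM2l ?invr_ge0 //; nra.
Qed.

Lemma sqrt_iter_dist n k x :
  nm (Y (k + n) x - Y n x) <= (c (k + n) - c n) * nm x.
Proof.
elim: k => [|k IH]; first by rewrite !subrr mul0r /nm normr0.
have -> : Y (k.+1 + n) x - Y n x =
    (Y (k + n).+1 x - Y (k + n) x) + (Y (k + n) x - Y n x).
  by rewrite addrA subrK.
apply: le_trans (nmD _ _) _.
have := sqrt_iter_incr (k + n) x; move: IH; rewrite addSn; lra.
Qed.

Lemma sqrt_iter_cauchy x : cauchy0 (fun n m => nsq (Y n x - Y m x)).
Proof.
(* The telescoped increments are at most [1 - c n] times the norm of [x]; as [1 - c n] lies in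
   [0, 1], its square is again at most [1 - c n]. *)
apply: (@cauchy0_lim _ (fun n => (1 - c n) * nsq x)).
  apply: (@lim0_le _ (2 * nsq x)) (@invS_lim0 R).
    by rewrite mulr_ge0 ?(nsq_ge0 norm_dot).
  move=> n; have [_] := sqrt_coef_le n.
  have := nsq_ge0 norm_dot x; move: (nsq x) (n.+1%:R^-1) => a b *; nra.
have main n k : nsq (Y (k + n) x - Y n x) <= (1 - c n) * nsq x.
  have [c0 _] := sqrt_coef_le n; have c1 := sqrt_coef_le1 n.
  have h := sqrt_iter_dist n k x; have ck := sqrt_coef_le1 (k + n).
  have x0 := nm_ge0 x; rewrite !nsq_nm.
  have h1 : nm (Y (k + n) x - Y n x) <= (1 - c n) * nm x.
    by apply: le_trans h _; rewrite ler_wpM2r //; lra.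
  apply: (@le_trans _ _ (((1 - c n) * nm x) ^+ 2)).
    by rewrite ler_sqr ?nnegrE ?nm_ge0 // mulr_ge0 // subr_ge0.
  by rewrite exprMn ler_wpM2r ?sqr_ge0 //; nra.
have pos n : 0 <= (1 - c n) * nsq x.
  by rewrite mulr_ge0 ?(nsq_ge0 norm_dot) // subr_ge0 sqrt_coef_le1.
move=> n m; have [nm|mn] := leqP n m.
  rewrite -opprB /nsq rdotNl rdotNr opprK; have := main n (m - n)%N.
  by rewrite subnK // /nsq; have := pos m; rewrite /nsq; lra.
have := main m (n - m)%N; rewrite subnK 1?ltnW //.
by have := pos n; lra.
Qed.

(** [W] is I - Z with Z the limit of the iteration. The commutation clause is needed because several
    such roots are combined later. *)
Lemma sqrt_contraction : exists W : H -> H,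
  [/\ contraction (fun x => x - W x), symmetric_op W,
      forall x, W (W x) = x - K x, forall x, 0 <= rdot (W x) x &
      forall C, contraction C -> (forall x, C (K x) = K (C x)) ->
        forall x, C (W x) = W (C x)].
Proof.
have /choice[Z hZ] x : exists z, cvs (fun n => Y n x) z.
  exact/(cvs_complete norm_dot)/sqrt_iter_cauchy.
have uniq u y z := @cvs_uniq _ _ _ norm_dot u y z.
have Zl (a : R[i]) x y : Z (a *: x + y) = a *: Z x + Z y.
  apply: uniq (hZ _) _.
  under [fun n => _]eq_fun do rewrite sqrt_iter_lin.
  by apply: cvsD => //; exact: cvsZ.
have Zle x : nsq (Z x) <= nsq x.
  rewrite !nsq_nm ler_sqr ?nnegrE ?nm_ge0 //; apply: ler_addeps => e e0.
  have [N /(_ N (leqnn N))] := hZ x (e ^+ 2) (exprn_gt0 2 e0).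
  rewrite nsq_nm ltr_sqr ?nnegrE ?nm_ge0 ?(ltW e0) // => h.
  have h1 := nmD (Z x - Y N x) (Y N x); rewrite subrK in h1.
  have h2 : nm (Z x - Y N x) = nm (Y N x - Z x) by rewrite /nm distrC.
  have h3 := sqrt_iter_le N x; have h4 := sqrt_coef_le1 N; have x0 := nm_ge0 x.
  have : c N * nm x <= 1 * nm x by rewrite ler_wpM2r.
  lra.
have cZ : contraction Z by [].
have Zs : symmetric_op Z.
  move=> x y; apply: lim0_sqr_uniq (cvs_rdot norm_dot y (hZ x)) _.
  have := cvs_rdot norm_dot x (hZ y).
  by under [fun n => (rdot _ x - _) ^+ 2]eq_fun do
    rewrite rdotC -sqrt_iter_sym (rdotC _ (Z y)).
have Yctr n : contraction (Y n).
  split; first exact: sqrt_iter_lin.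
  move=> x; rewrite !nsq_nm ler_sqr ?nnegrE ?nm_ge0 //.
  apply: le_trans (sqrt_iter_le _ _) _; rewrite ler_piMl ?nm_ge0 //.
  exact: sqrt_coef_le1.
(* The recursion passes to the limit since every [Y n] is a contraction. The fixed-point equation 2Z
   = K + Z^2 says (I - Z)^2 = I - K. *)
have Z2 x : Z x = (2^-1)%:C *: (K x + Z (Z x)).
  apply: (uniq (fun n => Y n.+1 x)).
    by move=> e /(hZ x)[N hN]; exists N => n /leqW /hN.
  apply: cvsZ; have h := lim0D (hZ x) (hZ (Z x)).
  apply: (@lim0_le _ 2) h => // n.
  have -> : K x + Y n (Y n x) - (K x + Z (Z x)) =
      Y n (Y n x - Z x) + (Y n (Z x) - Z (Z x)).
    by rewrite (linB (sqrt_iter_lin n)) addrA subrK opprD addrACA subrr add0r.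
  apply: le_trans (sip_DD_le (rdot_inner norm_dot) _ _) _ => //.
  by rewrite ler_wpM2l // lerD2r; exact: (ctr_le (Yctr n)).
exists (fun x => x - Z x); split.
- by split=> [a x y|x]; rewrite !subKr.
- by move=> x y; rewrite rdotBl rdotBr Zs.
- move=> x; rewrite (linB Zl).
  have : Z x + Z x = K x + Z (Z x).
    rewrite [in LHS]Z2 -scalerDl -rmorphD /=.
    have -> : 2^-1 + 2^-1 = 1 :> R by field.
    by rewrite scale1r.
  move=> e; have -> : K x = Z x + Z x - Z (Z x) by rewrite e addrK.
  by rewrite -addrA -opprD addrA.
- by move=> x; rewrite rdotBl subr_ge0; exact: ctr_form_le.
- move=> C [Cl Cle] CK x; rewrite (linB Cl); congr (_ - _).
  apply: uniq (ctr_cvs (Contraction Cl Cle) (hZ x)) _.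
  have e n : C (Y n x) = Y n (C x) by apply: sqrt_iter_comm.
  by rewrite /comp; under eq_fun do rewrite e; exact: hZ.
Qed.

End SquareRootOfContraction.

(** * Existence of A_o^{1/2} and the form of a relation *)

Section FormOfRelation.
Variables (R : realType) (H : completeNormedModType R[i]).
Variable dot : {dot H for (@Num.conj R[i])}.
Hypothesis norm_dot : forall x : H, `|x| ^+ 2 = dot x x.
Local Notation rdot := (rdot dot).
Local Notation mul := Defs.mul.
Local Notation nsq := (nsq dot).
Local Notation cvs := (cvs dot).
Implicit Types (x y z : H) (A B S : set (H * H)) (M N : set H) (t s : sform H).

Lemma orth_subspace N : subspace (orth dot N).
Proof.
split=> [m _|a x y hx hy m Nm]; first exact: linear0l.
by rewrite linearPl /= hx // hy // mulr0 addr0.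
Qed.

Lemma orth_rdot M x :
  subspace M -> (forall m, M m -> rdot x m = 0) -> orth dot M x.
Proof.
move=> hM h m Mm; apply: complex_eq; first exact: h.
by rewrite Im_dot h //; exact: (subspaceZ _ hM).
Qed.

Lemma rdot_orth M x m : orth dot M x -> M m -> rdot x m = 0.
Proof. by rewrite /rdot => h /h ->. Qed.

Lemma orth_seq_closed N (u : nat -> H) x :
  (forall n, orth dot N (u n)) -> cvs u x -> orth dot N x.
Proof.
move=> Nu ux.
have h z : (forall n, rdot (u n) z = 0) -> rdot x z = 0.
  move=> h; have := cvs_rdot norm_dot z ux.
  under eq_fun do rewrite h.
  move=> /lim0_sqr_uniq; apply; apply: (@lim0_le _ 1) (@invS_lim0 R) => // n.
  by rewrite subrr expr0n mul1r /= invr_ge0.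
move=> m Nm; apply: complex_eq; first by apply: h => n; exact: rdot_orth (Nu n) Nm.
by rewrite Im_dot; apply: h => n; rewrite -Im_dot (Nu n).
Qed.

(** Orthogonal projection by Riesz for (x, .) on [orth N]; this subspace is closed whatever [N]
    is. *)
Lemma orth_proj N x : exists2 m, orth dot N m & orth dot (orth dot N) (x - m).
Proof.
have hN := orth_subspace N.
have hp : semi_inner (orth dot N) rdot.
  split=> // *; [exact: rdotDl | exact: rdotZl | exact: rdotC | exact: nsq_ge0].
have [||||u [Nu cu lu]] := sip_riesz hp (l := rdot x) (C := nsq x).
- by move=> *; rewrite rdotDr.
- by move=> *; rewrite rdotZr.
- exact: nsq_ge0.
- by move=> *; apply: (sip_CS (rdot_inner norm_dot)).
have [w uw] := cvs_complete norm_dot cu.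
exists w; first exact: orth_seq_closed Nu uw.
apply: orth_rdot => // z Nz; rewrite rdotBl; apply/eqP; rewrite subr_eq0; apply/eqP.
exact: lim0_sqr_uniq (lu z Nz) (cvs_rdot norm_dot z uw).
Qed.

Lemma mul_orth A : nsa dot A -> mul A = orth dot (dom A).
Proof.
move=> nA; apply/seteqP; split=> [m Am x [y Axy]|m hm].
  have : adjoint dot A (0, m) by rewrite (nsa_adj nA).
  by move=> /(_ _ Axy) /=; rewrite linear0r (dotC _ m) => <-; rewrite conjc0.
rewrite /mul /= -(nsa_adj nA) => -[x y] Axy /=.
by rewrite linear0r dotC hm ?conjc0 //; exists y.
Qed.

Lemma nsa_proj A x :
  nsa dot A -> exists2 m, mul A m & orth dot (mul A) (x - m).
Proof. by move=> /mul_orth ->; exact: orth_proj. Qed.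

Lemma dom_orth_mul A f : nsa dot A -> A f -> orth dot (mul A) f.1.
Proof.
move=> /mul_orth -> Af m hm; rewrite dotC hm ?conjc0 //.
by exists f.2; rewrite -surjective_pairing.
Qed.

Lemma nsa_sum_inj A f g :
  nsa dot A -> A f -> A g -> f.1 + f.2 = g.1 + g.2 -> f.1 = g.1.
Proof.
move=> nA Af Ag e; have := nsa_ge0 nA (subspaceB (nsa_sub nA) Af Ag) => /=.
have -> : f.2 - g.2 = - (f.1 - g.1).
  have -> : f.2 = g.1 + g.2 - f.1 by rewrite -e addrC addKr.
  by rewrite opprB addrAC addrK.
rewrite rdotNl oppr_ge0 => /(nsq_eq0 norm_dot)/eqP.
by rewrite subr_eq0 => /eqP.
Qed.

Lemma square_root_contraction (C W : H -> H) :
  contraction dot C -> symmetric_op dot W -> contraction dot (fun x => x - W x) ->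
  (forall x, W (W x) = C x) -> contraction dot W.
Proof.
move=> cC sW cW W2; split=> [a x y|x].
  have WE z : W z = z - (z - W z) by rewrite subKr.
  by rewrite [LHS]WE (ctr_lin cW) opprD addrACA -scalerBr !subKr.
rewrite {1}/nsq sW W2 rdotC; exact: (ctr_form_le norm_dot).
Qed.

Lemma sym_ge0 x y : dot x y = dot y x -> 0 <= rdot x y -> 0 <= dot x y.
Proof.
move=> e h; apply: complex_ge0 => //; move: e; rewrite (dotC _ y).
by case: (dot x y) => a b [] /=; lra.
Qed.

(** Writing the square of an orthogonal complement as an adjoint makes its closedness a case of
    [adjoint_closed]. *)
Lemma setX_orth M : subspace M ->
  orth dot M `*` orth dot M = adjoint dot (M `*` M).
Proof.
move=> hM; apply/seteqP; split=> [g [h1 h2] f [Mf1 Mf2]|g hg].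
  by rewrite (dotC _ f.2) (dotC _ f.1) h1 // h2.
split=> m Mm; rewrite dotC; apply/eqP; rewrite conjc_eq0; apply/eqP.
  have /= -> := hg (0, m) (conj hM.1 Mm); exact: linear0l.
have /= <- := hg (m, 0) (conj Mm hM.1); exact: linear0l.
Qed.

(* With T = (A + I)^{-1}, the square root of the operator part is the relation
   {(T^{1/2} x, (I - T)^{1/2} x) : x orthogonal to mul A}. *)
Lemma oper_part_root A : nsa dot A -> exists B,
  [/\ nonneg_selfadjoint_in dot (orth dot (mul A)) B, mul B = [set 0] &
      (B \; B)%relation = oper_part dot A].
Proof.
move=> nA; have hA := nsa_sub nA; set M := mul A; set L := orth dot M.
have hM : subspace M by rewrite /M (mul_orth nA); exact: orth_subspace.
have hL : subspace L := orth_subspace M.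
have /choice[T AT] (h : H) : exists y, A (y, h - y).
  have [f Af <-] := nsa_range norm_dot h nA.
  by exists f.1; rewrite [f.1 + _]addrC addrK -surjective_pairing.
have TE f : A f -> T (f.1 + f.2) = f.1.
  move=> Af; apply: (nsa_sum_inj (f := (_, _)) nA (AT _) Af).
  by rewrite /= addrC subrK.
have Tlin (a : R[i]) x y : T (a *: x + y) = a *: T x + T y.
  have /TE /= := hA.2 a _ _ (AT x) (AT y).
  have -> : a *: T x + T y + (a *: (x - T x) + (y - T y)) = a *: x + y => //.
  by rewrite addrACA -scalerDr ![T _ + _]addrC !subrK.
have Tle x : nsq (T x) <= nsq x /\ nsq (x - T x) <= nsq x.
  have := nsa_ge0 nA (AT x); rewrite /= => h.
  have := sipDD (rdot_inner norm_dot) (x := x - T x) (y := T x) I I.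
  rewrite subrK -/(nsq x) -/(nsq _) -/(nsq (T x)).
  have := nsq_ge0 norm_dot (T x); have := nsq_ge0 norm_dot (x - T x).
  by rewrite -/(nsq _) -/(nsq _); lra.
have cT : contraction dot T by split=> // x; case: (Tle x).
have sT : symmetric_op dot T.
  move=> x y; have := nsa_sym nA (AT x) (AT y); rewrite /= rdotBl rdotBr.
  by rewrite (rdotC _ y) (rdotC _ (T y)) (rdotC _ (T y)); lra.
have cT' : contraction dot (fun x => x - T x).
  split=> [a x y|x]; last by case: (Tle x).
  by rewrite Tlin scalerBr opprD addrACA.
have sT' : symmetric_op dot (fun x => x - T x).
  by move=> x y; rewrite rdotBl rdotBr sT.
have T0 : T 0 = 0 by have := linB Tlin 0 0; rewrite !subrr.
(* Thus mul A is the kernel of T, and operators commuting suitably with T leave its orthogonal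
   complement [L] invariant. *)
have MT m : M m <-> T m = 0.
  split=> [/TE /=|e]; first by rewrite add0r.
  by have := AT m; rewrite e subr0.
(* [P] is T^{1/2}, from K = I - T, and [Q] is (I - T)^{1/2}, from K = T. *)
have [P [cP' sP PP _ commP]] := sqrt_contraction norm_dot cT' sT'.
have [Q [cQ' sQ QQ Q_ge0 commQ]] := sqrt_contraction norm_dot cT sT.
have {}PP x : P (P x) = T x by rewrite PP subKr.
have cP := square_root_contraction cT sP cP' PP.
have cQ := square_root_contraction cT' sQ cQ' QQ.
have TP x : T (P x) = P (T x) by apply: commP => // y; rewrite (linB Tlin).
have PQ x : P (Q x) = Q (P x) by apply: commQ.
have TQ x : T (Q x) = Q (T x) by apply: commQ.
have P0 : P 0 = 0 by have := linB (ctr_lin cP) 0 0; rewrite !subrr.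
have Q0 : Q 0 = 0 by have := linB (ctr_lin cQ) 0 0; rewrite !subrr.
(* A further root P^{1/2} commutes with [Q], so (Qx, Px) = (Q P^{1/2} x, P^{1/2} x). *)
have PQ_ge0 x : 0 <= rdot (Q x) (P x).
  have sP' : symmetric_op dot (fun x => x - P x).
    by move=> y z; rewrite rdotBl rdotBr sP.
  have [P1 [_ sP1 PP1 _ commP1]] := sqrt_contraction norm_dot cP' sP'.
  have {}PP1 y : P1 (P1 y) = P y by rewrite PP1 subKr.
  rewrite -PP1 -sP1 -commP1 //; last by move=> y; rewrite (linB (ctr_lin cQ)) PQ.
have LP x : L x -> L (P x).
  move=> Lx; apply: orth_rdot => // m Mm.
  have -> : rdot (P x) m = rdot x (P m) by [].
  suff -> : P m = 0 by rewrite rdot0r.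
  apply: (nsq_eq0 norm_dot); rewrite /nsq sP PP.
  by move/MT: Mm => ->; rewrite rdot0r.
have LQ x : L x -> L (Q x).
  move=> Lx; apply: orth_rdot => // m Mm; rewrite sQ.
  apply: rdot_orth Lx _; apply/MT; rewrite TQ.
  by move/MT: Mm => ->.
(* Since P^2 + Q^2 = I and [P], [Q] commute, [P x + Q y] is a common parameter: it recovers x and y
   from the compatibility condition alone. Both the adjoint and the composition are computed from
   this. *)
have key x y : Q x = P y -> P (P x + Q y) = x /\ Q (P x + Q y) = y.
  move=> e; rewrite (linD (ctr_lin cP)) (linD (ctr_lin cQ)) PP QQ PQ -e QQ.
  by rewrite -PQ e PP ![T _ + _]addrC !subrK.
pose B : set (H * H) := [set f | exists2 x, L x & f = (P x, Q x)].
have hB : subspace B.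
  split; first by exists 0; [exact: hL.1 | rewrite P0 Q0].
  move=> a _ _ [x Lx ->] [y Ly ->]; exists (a *: x + y); first exact: hL.2.
  by rewrite (ctr_lin cP) (ctr_lin cQ).
have Badj : adjoint dot B `&` (L `*` L) = B.
  apply/seteqP; split=> [[g1 g2] [/(adjointP _ _ hB) hg [/= L1 L2]]|_ [x Lx ->]].
    (* Membership in the adjoint says that the difference is orthogonal to [L]. It also lies in [L],
       so testing it against itself suffices. *)
    have e : Q g1 = P g2.
      have Lk : L (Q g1 - P g2) by apply: (subspaceB hL); [exact: LQ | exact: LP].
      apply/eqP; rewrite -subr_eq0; apply/eqP/(nsq_eq0 norm_dot).
      rewrite {1}/nsq rdotBr -sQ -sP; have /= -> := hg (_, _) (ex_intro2 _ _ _ Lk erefl).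
      by rewrite subrr.
    have [e1 e2] := key _ _ e; exists (P g1 + Q g2); last by rewrite e1 e2.
    by apply: (subspaceD hL); [exact: LP | exact: LQ].
  split; last by split; [exact: LP | exact: LQ].
  by apply/adjointP => // _ [y Ly ->] /=; rewrite -sP PQ sQ.
exists B; split.
- split=> //.
    split; [exact: hB.1 | exact: hB.2 | rewrite -Badj setX_orth //].
    apply: closedI; apply: adjoint_closed => //.
    split; first by split; exact: hM.1.
    by move=> a f g [? ?] [? ?]; split; apply: hM.2.
  move=> _ [x Lx ->] /=; apply: sym_ge0 => //.
  have : (adjoint dot B `&` (L `*` L)) (P x, Q x) by rewrite Badj; exists x.
  by move=> [/(_ (P x, Q x)) /= h _]; apply: h; exists x.
- apply/seteqP; split=> [y [x Lx [Px ->]]|_ ->]; last exact: hB.1.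
  have Mx : M x by apply/MT; rewrite -PP -Px P0.
  have -> : x = 0; last exact: Q0.
  by apply: (nsq_eq0 norm_dot); rewrite /nsq (rdot_orth Lx Mx).
- apply/seteqP; split=> [[f1 f2] /= [z [x Lx [-> zx]] [y Ly [zy ->]]]|].
    have [e1 e2] := key x y (etrans (esym zx) zy).
    split; last by split; [exact: LP | exact: LQ].
    by move: (P x + Q y) e1 e2 => w <- <-; rewrite PP QQ; exact: AT.
  move=> [f1 f2] [Af [/= L1 L2]]; have Tf := TE _ Af; rewrite /= in Tf.
  have Lf := subspaceD hL L1 L2.
  exists (P (Q (f1 + f2))).
    by exists (P (f1 + f2)); [exact: LP | rewrite PP Tf PQ].
  exists (Q (f1 + f2)); first exact: LQ.
  by rewrite QQ Tf addrAC subrr add0r.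
Qed.

Lemma sqrt_oper_partP A : nsa dot A ->
  let r := sqrt_oper_part dot A in
  [/\ nonneg_selfadjoint_in dot (orth dot (mul A)) r, mul r = [set 0] &
      (r \; r)%relation = oper_part dot A].
Proof. by move=> nA; exact: (xgetPex set0 (oper_part_root nA)). Qed.

(** Closedness of the form is closedness of the graph of the root. The identity with [A] is the
    definition of the adjoint of the root together with its square. *)
Lemma form_ofP A : nsa dot A ->
  closed_form dot (form_of dot A) /\ rel_of dot (form_of dot A) = A.
Proof.
move=> nA; have [] := sqrt_oper_partP nA; rewrite /form_of.
set r := sqrt_oper_part dot A; set L := orth dot (mul A).
move=> [[r0 rP rc] radj r_ge0] rmul rr.
have hr : subspace r by [].
have hL : subspace L := orth_subspace _.
have rL f : r f -> L f.1 /\ L f.2 by rewrite -{1}radj => -[].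
have rsym f g : r f -> r g -> rdot f.2 g.1 = rdot f.1 g.2.
  by move=> rf; rewrite -{1}radj => -[/(adjointP _ _ hr) /(_ _ rf)].
have rval_uniq x y z : r (x, y) -> r (x, z) -> y = z.
  move=> h1 h2; have := subspaceB hr h1 h2.
  have -> : (x, y) - (x, z) = (0, y - z) by rewrite -[0](subrr x).
  have -> : r (0, y - z) = mul r (y - z) by [].
  by rewrite rmul => /eqP; rewrite subr_eq0 => /eqP.
have valE x y : r (x, y) -> lr_val r x = y.
  move=> rxy; apply: rval_uniq (rxy).
  exact: (xgetPex 0 (ex_intro [set f' | r (x, f')] y rxy)).
have rval_in x : dom r x -> r (x, lr_val r x).
  by move=> [y rxy]; rewrite (valE _ _ rxy).
have hD : subspace (dom r).
  split; first by exists 0.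
  move=> a x y [x' rx] [y' ry]; exists (a *: x' + y'); exact: (rP a _ _ rx ry).
have val_lin a x y : dom r x -> dom r y ->
    lr_val r (a *: x + y) = a *: lr_val r x + lr_val r y.
  by move=> /rval_in rx /rval_in ry; apply: valE; exact: (rP a _ _ rx ry).
have val_sub x y : dom r x -> dom r y -> lr_val r (x - y) = lr_val r x - lr_val r y.
  by move=> Dx Dy; rewrite addrC -scaleN1r val_lin // scaleN1r addrC.
set t := SForm _ _; have ct : closed_form dot t.
  split=> //=.
  - by move=> a x y z Dx Dy Dz; rewrite val_lin // linearPl.
  - by move=> x y _ _; exact: dotC.
  - by move=> x _; exact: (nsq_ge0 norm_dot).
  move=> u x Du ux cu.
  have [|y vy] := @cvs_complete _ _ _ norm_dot (fun n => lr_val r (u n)).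
    apply: (@cauchy0_le _ 1) cu => // n m.
    by rewrite mul1r /rval /= val_sub.
  have rxy : r (x, y).
    rewrite -radj; split; last first.
      split=> /=.
        by apply: orth_seq_closed ux => n; have [] := rL _ (rval_in _ (Du n)).
      by apply: orth_seq_closed vy => n; have [] := rL _ (rval_in _ (Du n)).
    apply: (@adjoint_seq_closed _ _ _ norm_dot _ (fun n => (u n, lr_val r (u n)))) => // n.
    by have := rval_in _ (Du n); rewrite -{1}radj => -[].
  split; first by exists y.
  apply: (@lim0_le _ 1) vy => // n; rewrite mul1r /rval /= val_sub //; last by exists y.
  by rewrite (valE _ _ rxy).
split=> //; apply/seteqP; split=> [[f f'] [/= Df hf]|[f f'] Af].
  (* The square of the root only sees the operator part, so the component of [f'] in mul A is
     removed here and added back at the end. *)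
  have [m Mm Lm] := nsa_proj f' nA.
  have rg : r (lr_val r f, f' - m).
    suff : (adjoint dot r `&` (L `*` L)) (lr_val r f, f' - m) by rewrite radj.
    split; last by split; [exact: (rL _ (rval_in _ Df)).2 | exact: Lm].
    apply/adjointP => // -[x x'] rx /=.
    have Dx : dom r x by exists x'.
    have := hf _ Dx; rewrite /rval /= (valE _ _ rx) -/(rdot _ _) => e.
    rewrite rdotC e rdotC rdotBr; have [Lx _] := rL _ rx.
    by rewrite (rdot_orth Lx Mm) subr0.
  have : oper_part dot A (f, f' - m) by rewrite -rr; exists (lr_val r f) => //; exact: rval_in.
  move=> [Afm _]; have := subspaceD (nsa_sub nA) Afm (Mm : A (0, m)).
  have -> // : (f, f' - m) + (0, m) = (f, f') by congr (_, _); rewrite /= ?addr0 ?subrK.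
have [m Mm Lm] := nsa_proj f' nA; have Lf := dom_orth_mul nA Af.
have : oper_part dot A (f, f' - m).
  split; last by [].
  have := subspaceB (nsa_sub nA) Af (Mm : A (0, m)).
  by have -> : (f, f') - (0, m) = (f, f' - m) by congr (_, _); rewrite /= subr0.
rewrite -rr => -[g /= fg gm]; split=> /=; first by exists g.
move=> x Dx; rewrite /rval /= (valE _ _ fg) -/(rdot _ _).
rewrite -(rsym _ _ gm (rval_in _ Dx)) /= rdotBl.
have [Lx _] := rL _ (rval_in _ Dx).
by rewrite (rdotC _ m) (rdot_orth Lx Mm) subr0.
Qed.

End FormOfRelation.

(** * Extremal extensions, their means and the iteration *)

Section ExtremalExtensions.
Variables (R : realType) (H : completeNormedModType R[i]).
Variable dot : {dot H for (@Num.conj R[i])}.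
Hypothesis norm_dot : forall x : H, `|x| ^+ 2 = dot x x.
Local Notation rdot := (rdot dot).
Local Notation nsq := (nsq dot).
Local Notation cvs := (cvs dot).
Local Notation nsa := (nsa dot).
Local Notation closed_form := (closed_form dot).
Local Notation rel_of := (rel_of dot).
Local Notation form_of := (form_of dot).
Implicit Types (x y z : H) (A B S : set (H * H)) (t s : sform H).

Lemma form_eq_trans t s u : form_eq t s -> form_eq s u -> form_eq t u.
Proof.
move=> [e1 h1] [e2 h2]; split; first by rewrite e1.
by move=> x y Dx Dy; rewrite h1 // h2 // -e1.
Qed.

Lemma form_eq_sym t s : form_eq t s -> form_eq s t.
Proof. by move=> [e h]; split=> // x y Dx Dy; rewrite h // e. Qed.

Lemma form_of_rel_of t : closed_form t -> form_eq (form_of (rel_of t)) t.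
Proof.
move=> ct; have [ca ra] := form_ofP norm_dot (rel_of_nsa norm_dot ct).
exact: (form_eq_rel_of norm_dot).
Qed.

(** [rel_of s] shows that the [xget] has a candidate, and [form_ofP] shows that every candidate
    equals it. *)
Lemma lr_of_formE t s :
  closed_form s -> form_eq t s -> lr_of_form dot t = rel_of s.
Proof.
move=> cs ts; rewrite /lr_of_form; case: xgetP => [A _ [/(nsaP norm_dot) nA At]|].
  have [_ <-] := form_ofP norm_dot nA.
  exact: rel_of_form_eq (form_eq_trans At ts).
move=> /(_ (rel_of s))[]; split; first exact/(nsaP norm_dot)/rel_of_nsa.
exact: form_eq_trans (form_of_rel_of cs) (form_eq_sym ts).
Qed.

Lemma nsa_dom A f x : nsa A -> A f -> fdom (form_of A) x ->
  fdom (form_of A) f.1 /\ rval (form_of A) f.1 x = rdot f.2 x.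
Proof.
move=> nA; have [_ {1}<-] := form_ofP norm_dot nA.
by move=> [Df hf] Dx; split => //; exact: hf.
Qed.

Lemma nsa_fdom A f : nsa A -> A f -> fdom (form_of A) f.1.
Proof. by move=> nA; have [_ {1}<-] := form_ofP norm_dot nA => -[]. Qed.

(** The factor 1 gives the form sum and 1/2 its half: scaling a relation by r scales its form by
    r. *)
Definition scaled_sum (r : R) t s : sform H :=
  SForm (fdom t `&` fdom s) (fun x y => r%:C * (fval t x y + fval s x y)).

Lemma rval_scaled_sum r t s x y :
  rval (scaled_sum r t s) x y = r * (rval t x y + rval s x y).
Proof. by rewrite /rval /= Re_mulR Re_add. Qed.

Lemma scaled_sum_closed r t s :
  0 < r -> closed_form t -> closed_form s -> closed_form (scaled_sum r t s).
Proof.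
move=> r0 ct cs; have hD := cf_sub ct; have hE := cf_sub cs; split.
- exact: (sip_sub (semi_innerD (form_inner ct) (form_inner cs))).
- move=> a x y z [? ?] [? ?] [? ?] /=.
  by rewrite (cf_lin ct) // (cf_lin cs) //; ring.
- move=> x y [? ?] [? ?] /=; rewrite (cf_herm ct) // (cf_herm cs) //.
  case: (fval t y x) => a b; case: (fval s y x) => c d.
  by apply: complex_eq => /=; ring.
- move=> x [Dx Ex]; rewrite rval_scaled_sum mulr_ge0 ?(ltW r0) //.
  by rewrite addr_ge0 ?(cf_ge0 ct) ?(cf_ge0 cs).
move=> u x Du ux cu.
have Dt n := (Du n).1; have Ds n := (Du n).2.
have rE z : r^-1 * rval (scaled_sum r t s) z z = rval t z z + rval s z z.
  by rewrite rval_scaled_sum mulrA mulVf ?gt_eqF // mul1r.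
have r1 : 0 <= r^-1 by rewrite invr_ge0 ltW.
have [|Dx lx] := cf_complete ct Dt ux.
  apply: (@cauchy0_le _ r^-1) cu => // n m.
  by rewrite rE lerDl (cf_ge0 cs) //; exact: (subspaceB hE).
have [|Ex ly] := cf_complete cs Ds ux.
  apply: (@cauchy0_le _ r^-1) cu => // n m.
  by rewrite rE lerDr (cf_ge0 ct) //; exact: (subspaceB hD).
split=> //; apply: (@lim0_leD _ r) lx ly; first exact: ltW.
by move=> n; rewrite rval_scaled_sum.
Qed.

Lemma half_form_sumE A B : nsa A -> nsa B ->
  half_form_sum dot A B = rel_of (scaled_sum 2^-1 (form_of A) (form_of B)).
Proof.
move=> nA nB; have [ca _] := form_ofP norm_dot nA.
have [cb _] := form_ofP norm_dot nB; have c1 := scaled_sum_closed ltr01 ca cb.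
rewrite /half_form_sum /form_sum (lr_of_formE c1); last first.
  by split=> //= x y _ _; rewrite mul1r.
have two (z : H) : 2 *: z = 2%:C *: z by rewrite rmorph_nat.
have half : (2^-1 : R[i]) = (2^-1)%:C by rewrite fmorphV rmorph_nat.
apply/seteqP; split=> [_ [f [Df hf] <-]|f [Df hf]].
  split=> //= x Dx; have := hf x Dx; rewrite !rval_scaled_sum mul1r => ->.
  by rewrite half rdotZl.
exists (f.1, 2%:C *: f.2); last first.
  by rewrite half /= scalerA -rmorphM /= mulVf // scale1r -surjective_pairing.
split=> //= x Dx; have := hf x Dx; rewrite !rval_scaled_sum rdotZl => <-.
by rewrite mulrA divff.
Qed.

Lemma half_form_sumC A B : half_form_sum dot A B = half_form_sum dot B A.
Proof.
rewrite /half_form_sum /form_sum; congr (scale_lr _ (lr_of_form _ _)).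
rewrite /add_form setIC; congr SForm.
by apply/funext => x; apply/funext => y; rewrite addrC.
Qed.

Lemma rel_invK A : (A^-1^-1)%relation = A.
Proof. by apply/seteqP; split=> -[]. Qed.

(** An epsilon version of the infimum condition; the lower bound 0 comes from nonnegativity of
    [A]. *)
Record extremal S A : Prop := Extremal {
  ext_nsa : nsa A;
  ext_sub : S `<=` A;
  ext_dense : forall f (e : R), A f -> 0 < e ->
    exists2 g, S g & rdot (f.2 - g.2) (f.1 - g.1) < e }.

Lemma extremalP S A : extremal_extension dot S A <-> extremal S A.
Proof.
split=> [[[/(nsaP norm_dot) nA SA] h]|[nA SA h]].
  split=> // f e Af e0.
  have : (ereal_inf [set (complex.Re (dot (f.2 - g.2) (f.1 - g.1)))%:E | g in S]
      < e%:E)%E by rewrite h // lte_fin.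
  by move=> /ereal_inf_lt[_ [g Sg <-]]; rewrite lte_fin; exists g.
split; first by split=> //; exact/(nsaP norm_dot).
move=> f Af; apply/eqP; rewrite eq_le; apply/andP; split.
  apply/lee_addgt0Pr => e e0; have [g Sg hg] := h f e Af e0.
  rewrite add0e; apply: le_trans (ereal_inf_lbound _) _; first by exists g.
  by rewrite lee_fin ltW.
apply/ereal_infP => _ [g Sg <-]; rewrite lee_fin.
exact: (nsa_ge0 nA (subspaceB (nsa_sub nA) Af (SA _ Sg))).
Qed.

(** The pairing in the extremality condition is symmetric under exchange of the two components. *)
Lemma extremal_inv S A :
  extremal S A -> extremal (S^-1)%relation (A^-1)%relation.
Proof.
move=> [nA SA h]; split; [exact: (nsa_inv norm_dot) | by move=> f /SA |].
move=> f e Af e0; have [g Sg hg] := h _ _ Af e0.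
exists (g.2, g.1); first by rewrite /= -surjective_pairing.
by rewrite rdotC.
Qed.

Lemma extremal_form_dense S A x (e : R) :
  extremal S A -> fdom (form_of A) x -> 0 < e ->
  exists2 g, S g & rval (form_of A) (x - g.1) (x - g.1) < e.
Proof.
move=> [nA SA h] Dx e0; have [ca ra] := form_ofP norm_dot nA.
have [u [Au _ lu]] := rel_of_dense norm_dot ca Dx.
(* [x] is first approximated within dom A, then within dom S by extremality; the factor 2 in
   [sip_triangle] accounts for the quarter. *)
have e4 : 0 < e / 4 by lra.
have {lu}[N /(_ N (leqnn N)) lu] := lu _ e4.
have Af : A (u N) by rewrite -ra.
have [g Sg hg] := h _ _ Af e4; exists g => //.
have Dg := nsa_fdom nA (SA _ Sg); have Du := nsa_fdom nA Af.
have hD := cf_sub ca.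
apply: le_lt_trans (sip_triangle (form_inner ca) Dx Du Dg) _.
rewrite (sipBC (form_inner ca) Dx Du).
have Afg := subspaceB (nsa_sub nA) Af (SA _ Sg).
have := (nsa_dom nA Afg (subspaceB hD Du Dg)).2 => /= ->; lra.
Qed.

Lemma extremal_form_le S A B x : extremal S A -> extremal S B ->
  fdom (form_of A) x -> fdom (form_of B) x ->
  rval (form_of A) x x <= rval (form_of B) x x.
Proof.
move=> eA eB Dx Ex; apply: ler_addeps => e e0.
have [nA SA _] := eA; have [nB SB _] := eB.
have [ca _] := form_ofP norm_dot nA; have [cb _] := form_ofP norm_dot nB.
have [g Sg hg] := extremal_form_dense eA Dx e0.
have Dg := nsa_fdom nA (SA _ Sg); have Eg := nsa_fdom nB (SB _ Sg).
have h2 := cf_ge0 cb (subspaceB (cf_sub cb) Ex Eg).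
(* After expansion the cross terms (g', x) and (g', g) depend on [S] alone, hence agree for both
   forms. *)
move: hg h2; rewrite (sipBB (form_inner ca)) // (sipBB (form_inner cb)) //.
rewrite (sipC (form_inner ca) Dx Dg) (sipC (form_inner cb) Ex Eg).
rewrite (nsa_dom nA (SA _ Sg) Dx).2 (nsa_dom nB (SB _ Sg) Ex).2.
rewrite (nsa_dom nA (SA _ Sg) Dg).2 (nsa_dom nB (SB _ Sg) Eg).2; lra.
Qed.

Lemma extremal_form_eq S A B x y : extremal S A -> extremal S B ->
  fdom (form_of A) x -> fdom (form_of B) x ->
  fdom (form_of A) y -> fdom (form_of B) y ->
  rval (form_of A) x y = rval (form_of B) x y.
Proof.
move=> eA eB Dx Ex Dy Ey.
have [ca _] := form_ofP norm_dot (ext_nsa eA).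
have [cb _] := form_ofP norm_dot (ext_nsa eB).
have q z : fdom (form_of A) z -> fdom (form_of B) z ->
    rval (form_of A) z z = rval (form_of B) z z.
  by move=> ? ?; apply/eqP; rewrite eq_le !(@extremal_form_le S).
have := q _ (subspaceD (cf_sub ca) Dx Dy) (subspaceD (cf_sub cb) Ex Ey).
rewrite (sipDD (form_inner ca)) // (sipDD (form_inner cb)) // q // (q y) //; lra.
Qed.

Lemma half_form_sum_extremal S A B : extremal S A -> extremal S B ->
  extremal S (half_form_sum dot A B) /\
  fdom (form_of (half_form_sum dot A B)) = fdom (form_of A) `&` fdom (form_of B).
Proof.
move=> eA eB; have [nA SA _] := eA; have [nB SB _] := eB.
have [ca _] := form_ofP norm_dot nA; have [cb _] := form_ofP norm_dot nB.
have r0 : 0 < 2^-1 :> R by rewrite invr_gt0.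
have ct := scaled_sum_closed r0 ca cb.
rewrite half_form_sumE //; set t := scaled_sum _ _ _ in ct *.
have nC := rel_of_nsa norm_dot ct.
split; last by have [-> _] := form_of_rel_of ct.
have tE x : fdom t x -> rval t x x = rval (form_of A) x x.
  move=> [Dx Ex]; rewrite rval_scaled_sum (extremal_form_eq eA eB) //; lra.
have SC : S `<=` rel_of t.
  move=> g Sg; split=> [|x [Dx Ex]].
    by split; [exact: nsa_fdom (SA _ Sg) | exact: nsa_fdom (SB _ Sg)].
  rewrite rval_scaled_sum (nsa_dom nA (SA _ Sg) Dx).2 (nsa_dom nB (SB _ Sg) Ex).2.
  lra.
split=> // f e Cf e0; have [[Df _] _] := Cf.
have [g Sg hg] := extremal_form_dense eA Df e0; exists g => //.
have [Dfg hfg] := subspaceB (nsa_sub nC) Cf (SC _ Sg).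
by have := hfg _ Dfg => /= <-; rewrite tE.
Qed.

Lemma half_form_sum_absorb S A B : extremal S A -> extremal S B ->
  fdom (form_of A) `<=` fdom (form_of B) -> half_form_sum dot A B = A.
Proof.
move=> eA eB AB; have nA := ext_nsa eA; have nB := ext_nsa eB.
have [ca {2}<-] := form_ofP norm_dot nA; have [cb _] := form_ofP norm_dot nB.
have r0 : 0 < 2^-1 :> R by rewrite invr_gt0.
rewrite half_form_sumE //; apply: rel_of_form_eq.
apply: form_eq_rval.
- exact: scaled_sum_closed.
- exact: ca.
- by apply/seteqP; split=> [x []|x Dx] //; split=> //; exact: AB.
move=> x y [Dx Ex] [Dy Ey]; rewrite rval_scaled_sum (extremal_form_eq eA eB) //; lra.
Qed.

Lemma lim0_ge (c : R) (a : nat -> R) : (forall n, c <= a n) -> lim0 a -> c <= 0.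
Proof.
move=> h ha; apply: lim0_cst; apply: (@lim0_le _ 1) ha => // n.
by rewrite mul1r.
Qed.

Lemma lim0_abs (a : nat -> R) (c : R) :
  lim0 (fun n => (a n - c) ^+ 2) -> lim0 (fun n => `|a n - c|).
Proof.
move=> h e e0; have [N hN] := h _ (exprn_gt0 2 e0); exists N => n /hN.
by move=> hn; rewrite ltr_norml; apply/andP; split; nra.
Qed.

(** For {v, x} in [A] this is Young's inequality for A[v, y] = (x, y), because A[v] = (x, v) =
    A^{-1}[x]. General x is reached through the core of A^{-1}. *)
Lemma form_duality A x y : nsa A ->
  fdom (form_of (A^-1)%relation) x -> fdom (form_of A) y ->
  2 * rdot x y <=
    rval (form_of (A^-1)%relation) x x + rval (form_of A) y y.
Proof.
move=> nA Dx Dy; have nI := nsa_inv norm_dot nA.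
have [ca _] := form_ofP norm_dot nA; have [ci ri] := form_ofP norm_dot nI.
have [u [Iu ux lu]] := rel_of_dense norm_dot ci Dx.
set q := rval (form_of (A^-1)%relation) in lu *; set a := rval (form_of A).
have {}Iu n : A ((u n).2, (u n).1) by have := Iu n; rewrite ri.
have Du n : fdom (form_of (A^-1)%relation) (u n).1.
  by apply: (nsa_fdom nI); exact: Iu.
have h1 := lim0_abs (cvs_rdot norm_dot y ux).
have h2 := lim0_abs (sip_lim (form_inner ci) Du Dx Dx lu).
have h := lim0D h1 h2.
(* The null sequence collects the errors of replacing x by [(u n).1], where q[u] - q[x] = q[u - x] +
   2 (q[u, x] - q[x]). *)
rewrite -subr_le0; apply: lim0_ge (_ : lim0 (fun n =>
  2 * (`|rdot (u n).1 y - rdot x y| + `|q (u n).1 x - q x x|) +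
  q ((u n).1 - x) ((u n).1 - x))); last first.
  by apply: lim0D lu; apply: (@lim0_le _ 2) h.
move=> n; have Dv := nsa_fdom nA (Iu n).
have y1 := sip_young (form_inner ca) Dv Dy; rewrite -/a in y1.
rewrite /a (nsa_dom nA (Iu n) Dy).2 /= -/a in y1.
have y2 : a (u n).2 (u n).2 = rdot (u n).1 (u n).2 := (nsa_dom nA (Iu n) Dv).2.
have y3 : q (u n).1 (u n).1 = rdot (u n).2 (u n).1 :=
  (nsa_dom nI (Iu n : (A^-1)%relation (u n)) (Du n)).2.
rewrite rdotC in y3; rewrite /= y2 -y3 in y1.
have -> : q ((u n).1 - x) ((u n).1 - x) = q (u n).1 (u n).1 - 2 * q (u n).1 x + q x x.
  exact: (sipBB (form_inner ci)).
have := ler_norm (rdot x y - rdot (u n).1 y); rewrite distrC.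
have := ler_norm (q (u n).1 x - q x x); lra.
Qed.

(* The bound [2 (f', x) <= (f', f) + c] for {f, f'} in h(A, B) is the average of
   the duality inequalities of A and of B. *)
Lemma harmonic_mean_dom A B : nsa A -> nsa B ->
  nsa (lr_harmonic_mean dot A B) ->
  fdom (form_of A) `&` fdom (form_of B) `<=`
    fdom (form_of (lr_harmonic_mean dot A B)).
Proof.
move=> nA nB nG x [Dx Ex]; have [cg rg] := form_ofP norm_dot nG.
have [ca _] := form_ofP norm_dot nA; have [cb _] := form_ofP norm_dot nB.
have nA' := nsa_inv norm_dot nA; have nB' := nsa_inv norm_dot nB.
set G := lr_harmonic_mean dot A B in nG rg cg *.
(* The average of A[x] and B[x] comes from the two dualities, and [nsq x] from Young's inequality
   for (f, x). *)
pose c := 2^-1 * (rval (form_of A) x x + rval (form_of B) x x) + nsq x.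
have c0 : 0 <= c.
  rewrite /c addr_ge0 ?(nsq_ge0 norm_dot) // mulr_ge0 ?invr_ge0 //.
  by rewrite addr_ge0 ?(cf_ge0 ca) ?(cf_ge0 cb).
have Gbound f : G f -> 2 * rdot x (f.1 + f.2) <= rdot (f.1 + f.2) f.1 + c.
  rewrite /G /lr_harmonic_mean half_form_sumE //= => -[[/= D1 D2] hf].
  have := hf _ (conj D1 D2); rewrite rval_scaled_sum /= => e.
  have y1 := form_duality nA D1 Dx; have y2 := form_duality nB D2 Ex.
  have y3 := sip_young (rdot_inner norm_dot) (x := f.1) (y := x) I I.
  rewrite rdotDr rdotDl (rdotC _ x f.1) (rdotC _ x f.2) (rdotC _ f.2 f.1) -e.
  by rewrite /c /nsq; lra.
apply: (rel_of_core norm_dot cg c0 _).1 => f; rewrite rg => Gf.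
(* Applying the bound to r f for every real r makes it homogeneous, as [rel_of_core] demands. *)
rewrite -sqrrN; apply: discr_le => r.
have := Gbound _ (subspaceZ r%:C (nsa_sub nG) Gf).
by rewrite /= -scalerDr rdotZr rdotZl rdotZr; lra.
Qed.

Lemma lr_harmonic_mean_extremal S A B : extremal S A -> extremal S B ->
  extremal S (lr_harmonic_mean dot A B).
Proof.
move=> /extremal_inv eA /extremal_inv eB.
have [/extremal_inv h _] := half_form_sum_extremal eA eB.
by rewrite rel_invK in h.
Qed.

Lemma mean_step_arithmetic S A B : extremal S A -> extremal S B ->
  half_form_sum dot (half_form_sum dot A B) (lr_harmonic_mean dot A B) =
    half_form_sum dot A B.
Proof.
move=> eA eB; have [eC CD] := half_form_sum_extremal eA eB.
have eG := lr_harmonic_mean_extremal eA eB.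
apply: (half_form_sum_absorb eC eG); rewrite CD.
by apply: harmonic_mean_dom; [exact: ext_nsa eA|exact: ext_nsa eB|exact: ext_nsa eG].
Qed.

(** The arithmetic step for the inverses: their half sum is the inverse of h(A, B), and their
    harmonic mean is the inverse of the half sum of A and B. *)
Lemma mean_step_harmonic S A B : extremal S A -> extremal S B ->
  lr_harmonic_mean dot (half_form_sum dot A B) (lr_harmonic_mean dot A B) =
    lr_harmonic_mean dot A B.
Proof.
move=> /extremal_inv eA /extremal_inv eB.
have := mean_step_arithmetic eA eB.
rewrite half_form_sumC /lr_harmonic_mean !rel_invK => e.
by rewrite [in LHS]e.
Qed.

Lemma ah_seqS S A B n : extremal S A -> extremal S B ->
  ah_seq dot A B n.+1 = (half_form_sum dot A B, lr_harmonic_mean dot A B).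
Proof.
move=> eA eB; elim: n => // n IH.
rewrite /ah_seq iterS -/(ah_seq dot A B n.+1) IH /=.
by rewrite (mean_step_arithmetic eA eB) (mean_step_harmonic eA eB).
Qed.

Lemma lr_val_resolvent A f :
  nsa A -> A f -> lr_val (resolvent A) (f.1 + f.2) = f.1.
Proof.
move=> nA Af.
have h : resolvent A (f.1 + f.2, f.1) by exists f; rewrite // addrC.
have [g Ag [e <-]] : resolvent A (f.1 + f.2, lr_val (resolvent A) (f.1 + f.2)).
  exact: (xgetPex 0 (ex_intro (fun y => resolvent A (f.1 + f.2, y)) f.1 h)).
by apply: (nsa_sum_inj norm_dot nA Ag Af); rewrite addrC.
Qed.

Lemma resolvent_inj A B : nsa A -> nsa B ->
  (forall x, lr_val (resolvent A) x = lr_val (resolvent B) x) -> A `<=` B.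
Proof.
move=> nA nB h f Af; have [g Bg e] := nsa_range norm_dot (f.1 + f.2) nB.
have := lr_val_resolvent nA Af; rewrite h -e (lr_val_resolvent nB Bg) => e1.
have e2 : f.2 = g.2 by apply: (addrI f.1); rewrite -e e1.
by rewrite (surjective_pairing f) -e1 e2 -surjective_pairing.
Qed.

(** Constancy starts at index 1, index 0 being the initial pair of the iteration. Uniqueness holds
    because the resolvent determines the relation. *)
Lemma sr_lim_const (An : nat -> set (H * H)) A :
  nsa A -> (forall n, An n.+1 = A) -> sr_lim dot An = A.
Proof.
move=> nA hA.
have cvA h : lr_val (resolvent (An n)) h @[n --> \oo] --> lr_val (resolvent A) h.
  apply/(cvsP norm_dot) => e e0; exists 1%N => -[//|n] _.
  by rewrite hA subrr /nsq rdot0l.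
rewrite /sr_lim; case: xgetP => [B _ [/(nsaP norm_dot) nB cvB]|]; last first.
  by move=> /(_ A)[]; split=> //; exact/(nsaP norm_dot).
have e x : lr_val (resolvent B) x = lr_val (resolvent A) x.
  apply: (cvs_uniq norm_dot (u := fun n => lr_val (resolvent (An n)) x)).
    exact/(cvsP norm_dot).
  exact/(cvsP norm_dot).
by apply/seteqP; split; apply: resolvent_inj.
Qed.

Lemma ahE S A B : extremal S A -> extremal S B ->
  ah dot A B = (half_form_sum dot A B, lr_harmonic_mean dot A B).
Proof.
move=> eA eB; have [eC _] := half_form_sum_extremal eA eB.
have eG := lr_harmonic_mean_extremal eA eB.
rewrite /ah; congr (_, _); apply: sr_lim_const.
- exact: ext_nsa eC.
- by move=> n; rewrite (ah_seqS n eA eB).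
- exact: ext_nsa eG.
- by move=> n; rewrite (ah_seqS n eA eB).
Qed.

End ExtremalExtensions.

(** * Friedrichs and Krein extensions *)

Section FriedrichsExtension.
Variables (R : realType) (H : completeNormedModType R[i]).
Variable dot : {dot H for (@Num.conj R[i])}.
Hypothesis norm_dot : forall x : H, `|x| ^+ 2 = dot x x.
Local Notation rdot := (rdot dot).
Local Notation nsq := (nsq dot).
Local Notation cvs := (cvs dot).
Local Notation nsa := (nsa dot).
Local Notation closed_form := (closed_form dot).
Local Notation rel_of := (rel_of dot).
Local Notation form_of := (form_of dot).
Local Notation extremal := (extremal dot).
Implicit Types (x y z : H) (A B S : set (H * H)) (t s : sform H).

Lemma lim0M (a b : nat -> R) : (forall n, 0 <= a n) -> (forall n, 0 <= b n) ->
  lim0 a -> lim0 b -> lim0 (fun n => a n * b n).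
Proof.
move=> a0 b0 ha hb e e0; have [N hN] := ha _ e0; have [M hM] := hb _ ltr01.
exists (maxn N M) => n; rewrite geq_max => /andP[/hN h1 /hM h2].
by have := a0 n; have := b0 n; nra.
Qed.

Lemma sip_lim2 (E : set H) (p : H -> H -> R) (u v : nat -> H) x y :
    semi_inner E p -> (forall n, E (u n)) -> (forall n, E (v n)) -> E x -> E y ->
    lim0 (fun n => p (u n - x) (u n - x)) ->
    lim0 (fun n => p (v n - y) (v n - y)) ->
  lim0 (fun n => (p (u n) (v n) - p x y) ^+ 2).
Proof.
move=> hp Eu Ev Ex Ey ux vy; have hE := sip_sub hp.
have Eux n := subspaceB hE (Eu n) Ex; have Evy n := subspaceB hE (Ev n) Ey.
have h1 := sip_lim hp Eu Ex Ey ux; have h2 := sip_lim hp Ev Ey Ex vy.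
have h3 : lim0 (fun n => p (u n - x) (v n - y) ^+ 2).
  have := lim0M (fun n => sip_ge0 hp (Eux n)) (fun n => sip_ge0 hp (Evy n)) ux vy.
  by apply: (@lim0_le _ 1) => // n; rewrite mul1r; exact: (sip_CS hp).
apply: (@lim0_leD _ 3) (lim0D h1 h2) h3 => // n.
rewrite (sipBl hp) // (sipBr hp) // (sipBr hp) //.
rewrite (sipC hp (Ev n) Ex) (sipC hp Ey Ex).
move: (p (u n) (v n)) (p (u n) y) (p x (v n)) (p x y) => a b c d.
(* The third summand is p(u - x, v - y), controlled by Cauchy-Schwarz; the constant 3 is that of (r
   + s + q)^2 <= 3 (r^2 + s^2 + q^2). *)
have -> : a - d = (b - d) + (c - d) + (a - b - (c - d)) by ring.
move: (b - d) (c - d) (a - b - (c - d)) => r s q.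
have := sqr_ge0 (r - s); have := sqr_ge0 (r - q); have := sqr_ge0 (s - q); lra.
Qed.

Lemma norm_complex_lt (w : R[i]) (e : R) : 0 < e ->
  complex.Re w ^+ 2 + complex.Im w ^+ 2 < e ^+ 2 -> `|w| < e%:C.
Proof.
move=> e0 h; rewrite normc_def ltcR -[ltRHS]ger0_norm ?(ltW e0) // -sqrtr_sqr.
by rewrite ltr_sqrt // exprn_gt0.
Qed.

Lemma complex_cvg (w : nat -> R[i]) (c : R[i]) :
  lim0 (fun n => (complex.Re (w n) - complex.Re c) ^+ 2) ->
  lim0 (fun n => (complex.Im (w n) - complex.Im c) ^+ 2) ->
  (w n : R[i]^o) @[n --> \oo] --> (c : R[i]^o).
Proof.
move=> h1 h2; apply/cvgrPdist_lt => _ /complex_gt0[e e0 ->].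
have [N hN] := lim0D h1 h2 (exprn_gt0 2 e0); exists N => // n /hN /= h.
rewrite distrC; apply: norm_complex_lt => //; move: h.
by move: (w n) => z {h1 h2 hN}; case: z => a b; case: c => c d.
Qed.

Lemma cvg_prod_cauchy0 (w : nat -> nat -> R[i]) :
    (forall n m, 0 <= w n m) ->
  (w k.1 k.2 : R[i]^o) @[k --> (\oo, \oo)] --> (0 : R[i]^o) <->
  cauchy0 (fun n m => complex.Re (w n m)).
Proof.
move=> w0.
have wE n m (e : R) : (`|0 - w n m| < e%:C) = (complex.Re (w n m) < e).
  rewrite sub0r normrN ger0_norm //; have := w0 n m.
  by case: (w n m) => a b; rewrite lecE ltcE /= eq_sym => /andP[/eqP -> _]; rewrite eqxx.
split=> [/cvgrPdist_lt h e e0|h].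
  have /h[[P Q] /= [[N _ hN] [M _ hM]] PQ] : 0 < e%:C :> R[i] by rewrite ltcR.
  exists (maxn N M) => n m; rewrite !geq_max => /andP[Nn _] /andP[_ Mm].
  by rewrite -wE; apply: (PQ (n, m)); split; [exact: hN | exact: hM].
apply/cvgrPdist_lt => _ /complex_gt0[e e0 ->]; have [N hN] := h _ e0.
exists ([set n | (N <= n)%N], [set n | (N <= n)%N]) => /=.
  by split; exists N.
by move=> [n m] /= [Nn Nm]; rewrite wE; exact: hN.
Qed.

Section ClosureInExtension.
Variables (S A : set (H * H)).
Hypotheses (hS : subspace S) (nA : nsa A) (SA : S `<=` A).

Let a := rval (form_of A).
Let p x y := a x y + rdot x y.
Let D := fdom (form_of A).
Let ca : closed_form (form_of A) := (form_ofP norm_dot nA).1.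
Let hp : semi_inner D p := form_inner1 norm_dot ca.
Let hD : subspace D := cf_sub ca.

(* The closure of the form of S, realised inside the form of an arbitrary
   nonnegative selfadjoint extension A; this makes closability immediate. *)
Definition closure_form : sform H :=
  SForm [set x | D x /\ forall e : R, 0 < e ->
                   exists2 g, S g & p (x - g.1) (x - g.1) < e]
        (fval (form_of A)).

Lemma dom_ext g : S g -> D g.1.
Proof. by move=> /SA; exact: nsa_fdom. Qed.

Lemma closure_form_dom g : S g -> fdom closure_form g.1.
Proof.
move=> Sg; split=> [|e e0]; first exact: dom_ext.
have := sipBl hp hD.1 hD.1 hD.1; rewrite !subrr => p0.
by exists g => //; rewrite subrr; have -> : p 0 0 = 0.
Qed.

Lemma closure_form_sub : subspace (fdom closure_form).
Proof.
split; first exact: (closure_form_dom hS.1).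
move=> c x y [Dx hx] [Dy hy]; split=> [|e e0]; first exact: hD.2.
(* With k = |c|^2 + 1, two errors below e / (4k) combine to at most 2k e / (4k) = e / 2. *)
pose k := complex.Re c ^+ 2 + complex.Im c ^+ 2 + 1.
have k1 : 1 <= k by rewrite lerDr addr_ge0 ?sqr_ge0.
have e1 : 0 < e / (4 * k) by rewrite divr_gt0 //; lra.
have [g Sg hg] := hx _ e1; have [h Sh hh] := hy _ e1.
exists (c *: g + h); first exact: hS.2.
have Dg := dom_ext Sg; have Dh := dom_ext Sh.
have Dxg := subspaceB hD Dx Dg; have Dyh := subspaceB hD Dy Dh.
have -> : c *: x + y - (c *: g + h).1 = c *: (x - g.1) + (y - h.1).
  by rewrite /= scalerBr opprD addrACA.
apply: le_lt_trans (sip_DD_le hp (subspaceZ c hD Dxg) Dyh) _.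
have -> : p (c *: (x - g.1)) (c *: (x - g.1)) = (k - 1) * p (x - g.1) (x - g.1).
  by rewrite /p /a (rvalZZ _ ca Dxg) [rdot (_ *: _) _]nsqZ -mulrDr /k addrK.
have p1 := sip_ge0 hp Dxg; have p2 := sip_ge0 hp Dyh.
have ek : e / (4 * k) * (4 * k) = e by rewrite divfK // gt_eqF //; lra.
move: hg hh p1 p2 ek; move: (p _ _) (p _ _) (e / (4 * k)) => b d r *.
nra.
Qed.

Lemma closure_form_closed : closed_form closure_form.
Proof.
have hC := closure_form_sub; split=> //=.
- by move=> c x y z [? _] [? _] [? _]; exact: (cf_lin ca).
- by move=> x y [? _] [? _]; exact: (cf_herm ca).
- by move=> x [? _]; exact: (cf_ge0 ca).
move=> u x Cu ux cu; have Du n := (Cu n).1.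
have [Dx lx] := cf_complete ca Du ux cu; do 2!split=> //.
move=> e e0; have e4 : 0 < e / 4 by lra.
have [N /(_ N (leqnn N)) hN] := lim0D lx ux e4.
have [g Sg hg] := (Cu N).2 _ e4; exists g => //.
apply: le_lt_trans (sip_triangle hp Dx (Du N) (dom_ext Sg)) _.
rewrite (sipBC hp Dx (Du N)); rewrite -/a -/(nsq _) in hN.
by move: hN hg; rewrite /p /nsq; lra.
Qed.

(** Whichever value [lr_val] picks, the pair lies in [S], hence in [A], and the form of [A] ignores
    the choice. *)
Lemma pre_form_val f g : S f -> D g ->
  dot (lr_val S f.1) g = fval (form_of A) f.1 g.
Proof.
move=> Sf Dg.
have Sv : S (f.1, lr_val S f.1).
  apply: (xgetPex 0 (ex_intro (fun y => S (f.1, y)) f.2 _)).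
  by rewrite -surjective_pairing.
have Dig := subspaceZ 'i%C hD Dg; have Df := dom_ext Sf.
apply: complex_eq; first by rewrite -[RHS]/(rval _ _ _) (nsa_dom norm_dot nA (SA Sv) Dg).2.
by rewrite Im_dot (Im_fval ca Df Dg) (nsa_dom norm_dot nA (SA Sv) Dig).2.
Qed.

(** Convergence for the form of [S] becomes convergence in the form norm of [A]: completeness of the
    latter supplies the limit of a Cauchy sequence. *)
Lemma form_cvg_ext (u : nat -> H) x : form_cvg (pre_form dot S) u x <->
  (forall n, dom S (u n)) /\ D x /\ lim0 (fun n => p (u n - x) (u n - x)).
Proof.
have SB (v w : H) : dom S v -> dom S w -> dom S (v - w).
  by move=> [v' Sv] [w' Sw]; exists (v' - w'); exact: (subspaceB hS Sv Sw).
have SD v : dom S v -> D v by move=> [v' /dom_ext].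
have val v : dom S v -> fval (pre_form dot S) v v = fval (form_of A) v v.
  by move=> Sv; have Dv := SD _ Sv; case: Sv => v' Sv; exact: (pre_form_val Sv).
have key (v : nat -> H) : (forall n, dom S (v n)) ->
    ((fval (pre_form dot S) (v k.1 - v k.2) (v k.1 - v k.2) : R[i]^o)
       @[k --> (\oo, \oo)] --> (0 : R[i]^o)) <->
    cauchy0 (fun n m => a (v n - v m) (v n - v m)).
  move=> Sv; have -> : (fun n m => a (v n - v m) (v n - v m)) = (fun n m =>
      complex.Re (fval (pre_form dot S) (v n - v m) (v n - v m))).
    by apply/funext => n; apply/funext => m; rewrite val //; exact: SB.
  apply: cvg_prod_cauchy0 => n m; have Svv := SB _ _ (Sv n) (Sv m).
  rewrite val //; have Dv := SD _ Svv.
  apply: complex_ge0; last exact: (cf_ge0 ca).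
  by have := cf_herm ca Dv Dv; case: (fval _ _ _) => b c [] /=; lra.
split=> [[Su /(cvsP norm_dot) ux] | [Su [Dx ux]]].
  move=> /(key _ Su) cu; have [|Dx lx] := cf_complete ca _ ux cu.
    by move=> n; exact: (SD _ (Su n)).
  by split=> //; split=> //; exact: lim0D.
have Du n := SD _ (Su n); have Dux n := subspaceB hD (Du n) Dx.
split=> //.
  apply/(cvsP norm_dot); apply: (@lim0_le _ 1) ux => // n.
  by rewrite mul1r lerDr; exact: (cf_ge0 ca (Dux n)).
apply/(key _ Su)/(sip_lim_cauchy (form_inner ca) Du Dx).
apply: (@lim0_le _ 1) ux => // n; rewrite mul1r lerDl.
exact: (nsq_ge0 norm_dot).
Qed.

Lemma form_closureE : form_eq (form_closure (pre_form dot S)) closure_form.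
Proof.
have SD v : dom S v -> D v by move=> [v' /dom_ext].
have approx x : fdom closure_form x -> exists u, form_cvg (pre_form dot S) u x.
  move=> [Dx hx].
  have /choice[u hu] (n : nat) :
      exists g, S g /\ p (x - g.1) (x - g.1) < n.+1%:R^-1.
    by have [|g Sg hg] := hx (n.+1%:R^-1); [rewrite invr_gt0 | exists g].
  exists (fun n => (u n).1); apply/form_cvg_ext; split; last split=> //.
    by move=> n; exists (u n).2; rewrite -surjective_pairing; case: (hu n).
  apply: (@lim0_le _ 1) (@invS_lim0 R) => // n; have [Su hn] := hu n.
  by rewrite mul1r (sipBC hp (dom_ext Su) Dx) ltW.
have domE : fdom (form_closure (pre_form dot S)) = fdom closure_form.
  apply/seteqP; split=> x; last by move=> /approx.
  move=> [u /form_cvg_ext[Su [Dx ux]]]; split=> // e /ux[N /(_ N (leqnn N)) hN].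
  have [v Sv] := Su N; exists (u N, v) => //=.
  by rewrite (sipBC hp Dx (SD _ (Su N))).
split=> // x y; rewrite domE => Cx Cy.
have cv (u v : nat -> H) : form_cvg (pre_form dot S) u x ->
    form_cvg (pre_form dot S) v y ->
  (fval (pre_form dot S) (u n) (v n) : R[i]^o) @[n --> \oo] -->
    (fval (form_of A) x y : R[i]^o).
  move=> /form_cvg_ext[Su [Dx ux]] /form_cvg_ext[Sv [Dy vy]].
  have Du n := SD _ (Su n); have Dv n := SD _ (Sv n).
  have val n : fval (pre_form dot S) (u n) (v n) = fval (form_of A) (u n) (v n).
    by have [w Sw] := Su n; exact: (pre_form_val Sw).
  have lim1 (w : nat -> H) z : (forall n, D (w n)) -> D z ->
      lim0 (fun n => p (w n - z) (w n - z)) ->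
      lim0 (fun n => a (w n - z) (w n - z)).
    move=> Dw Dz; apply: (@lim0_le _ 1) => // n; rewrite mul1r lerDl.
    exact: (nsq_ge0 norm_dot).
  (* Convergence of i v to i y handles the imaginary parts, by [Im_fval]. *)
  have iv : lim0 (fun n => a ('i%C *: v n - 'i%C *: y) ('i%C *: v n - 'i%C *: y)).
    apply: (@lim0_le _ 1) (lim1 _ _ Dv Dy vy) => // n.
    rewrite mul1r -scalerBr /a (rvalZZ _ ca (subspaceB hD (Dv n) Dy)) /=.
    by rewrite expr0n expr1n add0r mul1r.
  have := sip_lim2 (form_inner ca) Du (fun n => subspaceZ 'i%C hD (Dv n)) Dx
    (subspaceZ 'i%C hD Dy) (lim1 _ _ Du Dx ux) iv.
  have := sip_lim2 (form_inner ca) Du Dv Dx Dy (lim1 _ _ Du Dx ux) (lim1 _ _ Dv Dy vy).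
  move=> h1 h2; apply: complex_cvg.
    by under eq_fun do rewrite val.
  by under eq_fun do rewrite val (Im_fval ca (Du _) (Dv _)) (Im_fval ca Dx Dy).
(* Approximating sequences exist, so a value admissible for all of them is the limit along one of
   them. *)
rewrite /=; apply: xget_unique; first exact: cv.
move=> c hc; have [u ux] := approx _ Cx; have [v vy] := approx _ Cy.
exact: (@cvg_unique R[i]^o (@norm_hausdorff _ _) _ _ _ _ (hc _ _ ux vy) (cv _ _ ux vy)).
Qed.

Lemma friedrichsE : friedrichs dot S = rel_of closure_form.
Proof. exact: (lr_of_formE norm_dot closure_form_closed form_closureE). Qed.

Lemma friedrichs_extremal : extremal S (friedrichs dot S).
Proof.
rewrite friedrichsE; have nF := rel_of_nsa norm_dot closure_form_closed.
have SF : S `<=` rel_of closure_form.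
  move=> g Sg; split=> [|x [Dx _]]; first exact: closure_form_dom.
  exact: (nsa_dom norm_dot nA (SA Sg) Dx).2.
split=> // f e Ff e0; have [[Df hf] _] := Ff.
have [g Sg hg] := hf _ e0; exists g => //.
have [Dfg hfg] := subspaceB (nsa_sub nF) Ff (SF _ Sg).
have := hfg _ Dfg => /= <-; apply: le_lt_trans hg.
by rewrite /p lerDl; exact: (nsq_ge0 norm_dot).
Qed.

(** [friedrichs S] does not mention [A], while its form can be realised inside that of any
    extension; so the inclusion holds for each [A]. *)
Lemma friedrichs_dom : fdom (form_of (friedrichs dot S)) `<=` fdom (form_of A).
Proof.
rewrite friedrichsE.
by have [-> _] := form_of_rel_of norm_dot closure_form_closed; move=> x [].
Qed.

End ClosureInExtension.

Lemma friedrichs_absorb S A : subspace S -> extremal S A ->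
  half_form_sum dot (friedrichs dot S) A = friedrichs dot S.
Proof.
move=> hS eA; apply: (half_form_sum_absorb norm_dot _ eA).
  exact: (friedrichs_extremal hS (ext_nsa eA) (ext_sub eA)).
exact: (friedrichs_dom hS (ext_nsa eA) (ext_sub eA)).
Qed.

Lemma inv_subspace S : subspace S -> subspace (S^-1)%relation.
Proof.
by move=> [S0 SP]; split=> // c x y Sx Sy; exact: (SP c _ _ Sx Sy).
Qed.

Lemma krein_extremal S A : subspace S -> nsa A -> S `<=` A ->
  extremal S (krein dot S).
Proof.
move=> hS nA SA; rewrite -[S in extremal S _]rel_invK; apply: extremal_inv => //.
apply: (friedrichs_extremal (inv_subspace hS) (nsa_inv norm_dot nA)).
by move=> f; exact: SA.
Qed.

End FriedrichsExtension.

Unset Implicit Arguments.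
Set Strict Implicit.

Theorem proposition7p2 (R : realType) (H : completeNormedModType R[i])
    (dot : {dot H for (@Num.conj R[i])})
    (norm_dot : forall x : H, `|x| ^+ 2 = dot x x)
    (S : set (H * H))
    (S_nonneg_symmetric : nonneg_symmetric dot S)
    (S_nonunique : exists A B : set (H * H),
       [/\ nonneg_sa_extension dot S A, nonneg_sa_extension dot S B & A <> B]) :
  (forall S1 S2 : set (H * H),
     extremal_extension dot S S1 -> extremal_extension dot S S2 ->
     [/\ extremal_extension dot S (ah dot S1 S2).1,
         extremal_extension dot S (ah dot S1 S2).2 &
         ah dot S1 S2 = (half_form_sum dot S1 S2, lr_harmonic_mean dot S1 S2)])
  /\ ah dot (friedrichs dot S) (krein dot S)
     = (friedrichs dot S, krein dot S).
Proof.
have hS : subspace S by case: S_nonneg_symmetric => -[].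
(* One of the two given extensions hosts the closure of the form of [S], and its inverse that of
   [S^-1]. *)
have [A [_ [[/(nsaP norm_dot) nA SA] _ _]]] := S_nonunique.
have eF := friedrichs_extremal norm_dot hS nA SA.
have eK := krein_extremal norm_dot hS nA SA.
split=> [S1 S2 /(extremalP norm_dot) e1 /(extremalP norm_dot) e2|].
  rewrite (ahE norm_dot e1 e2); split=> //; apply/(extremalP norm_dot).
    by have [] := half_form_sum_extremal norm_dot e1 e2.
  exact: lr_harmonic_mean_extremal.
rewrite (ahE norm_dot eF eK) (friedrichs_absorb norm_dot hS eK).
(* The inverse of the Krein extension is the Friedrichs extension of [S^-1]; it absorbs the inverse
   of [friedrichs S], which is extremal for [S^-1]. *)
congr (_, _); rewrite /lr_harmonic_mean half_form_sumC {1}/krein rel_invK.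
rewrite (friedrichs_absorb norm_dot (inv_subspace hS)) //.
exact: extremal_inv.
Qed.
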